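(* Consider the secure ISAC model with full secrecy and perfect output feedback with state law $P_{S_1S_2}$, channel $P_{Y_1Y_2|S_1S_2X}$ and distortion metrics $d_1,d_2$. The secrecy-distortion region $\mathcal{R}_{\mathrm{POF}}$ is included in the union over all probability distributions $P_X$ on $\mathcal X$ of the tuples $(R,D_1,D_2)$ with $R\ge0$ satisfying $$D_j\ge \mathbb{E}[d_j(S_j,\widehat S_j)],\quad j=1,2,$$ $$R\le\min\Big\{H(Y_1,S_1|Y_2,S_2)-H(S_1|Y_1,Y_2,S_2,X),\; I(X;Y_1|S_1)\Big\},$$ where $P_{XY_1Y_2S_1S_2}=P_XP_{S_1S_2}P_{Y_1Y_2|S_1S_2X}$ and one can take $\widehat S_j=\mathsf{Est}_j(X,Y_1,Y_2)$ with the deterministic per-letter estimators $$\mathsf{Est}_j(x,y_1,y_2)=\operatorname*{argmin}_{\tilde s\in\widehat{\mathcal S}_j}\sum_{s_j\in\mathcal S_j}P_{S_j|XY_1Y_2}(s_j|x,y_1,y_2)\,d_j(s_j,\tilde s),\quad j=1,2.$$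
   Context: Notation: $H$ and $I$ denote entropy and mutual information; all logarithms are natural. Model (secure ISAC with full secrecy and perfect output feedback). All alphabets $\mathcal S_1,\mathcal S_2,\widehat{\mathcal S}_1,\widehat{\mathcal S}_2,\mathcal X,\mathcal Y_1,\mathcal Y_2$ are finite. The state pairs $(S_{1,i},S_{2,i})$, $i=1,\dots,n$, are i.i.d. with known law $P_{S_1S_2}$. The channel $P_{Y_1Y_2|S_1S_2X}$ is known and memoryless. The message $M$ is uniform on $\mathcal M$ and independent of the states. The transmitter forms $X_i=\mathsf{Enc}_i(M,Z^{i-1})\in\mathcal X$ for $i=1,\dots,n$, where $Z_{i}=(Y_{1,i},Y_{2,i})$ is the delayed perfect output feedback; the encoding functions may use private randomness independent of the message, states and channel noise. The legitimate receiver observes $(Y_1^n,S_1^n)$ and forms $\widehat M=\mathsf{Dec}(Y_1^n,S_1^n)$. The eavesdropper observes $(Y_2^n,S_2^n)$. The transmitter forms state estimates $\widehat{S_j^n}=\mathsf{Est}_j(X^n,Y_1^n,Y_2^n)\in\widehat{\mathcal S}_j^n$, $j=1,2$. The per-letter distortion metrics $d_j:\mathcal S_j\times\widehat{\mathcal S}_j\to[0,\infty)$ are bounded and $d_j(s^n,\widehat{s^n})=\frac1n\sum_{i=1}^n d_j(s_i,\widehat s_i)$. Achievability. A tuple $(R,D_1,D_2)$ with $R\ge0$ is achievable if, for every $\delta>0$, there exist $n\ge1$, an encoder, a decoder and two estimators such that: $\frac1n\log|\mathcal M|\ge R-\delta$; $\Pr[M\ne\widehat M]\le\delta$; $I(M;Y_2^n|S_2^n)\le\delta$;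 and $\mathbb E[d_j(S_j^n,\widehat{S_j^n})]\le D_j+\delta$ for $j=1,2$. The region $\mathcal R_{\mathrm{POF}}$ is the closure of the set of all achievable tuples. *)

(* Defs.v *)
From HB Require Import structures.
From mathcomp Require Import all_boot all_order all_algebra.
From mathcomp Require Import all_classical all_reals all_analysis.

Set Implicit Arguments.
Unset Strict Implicit.
Unset Printing Implicit Defensive.

Import Order.TTheory GRing.Theory Num.Theory numFieldNormedType.Exports.
Local Open Scope classical_set_scope.
Local Open Scope ring_scope.

Section FiniteProbability.
Context {R : realType}.

Definition is_pmf (A : finType) (p : A -> R) : Prop :=
  (forall a, 0 <= p a) /\ \sum_a p a = 1.

(* Random variables are functions on a finite sample space [T] carrying the
   probability mass function [P]. *)
Context {T : finType} (P : T -> R).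

Definition prob (E : pred T) : R := \sum_(w | E w) P w.

Definition expect (f : T -> R) : R := \sum_w P w * f w.

Definition law (A : finType) (f : T -> A) (a : A) : R :=
  prob [pred w | f w == a].

Definition pair_rv (A B : finType) (f : T -> A) (g : T -> B) (w : T) : A * B :=
  (f w, g w).

(* P(f = a | g = b), with value 0 when P(g = b) = 0. *)
Definition cond_law (A B : finType) (f : T -> A) (g : T -> B) (a : A) (b : B)
    : R :=
  law (pair_rv f g) (a, b) / law g b.

(* H(f | g), in nats. The convention 0 ln 0 = 0 holds since [ln 0 = 0]. *)
Definition cond_entropy (A B : finType) (f : T -> A) (g : T -> B) : R :=
  - \sum_a \sum_b law (pair_rv f g) (a, b) * ln (cond_law f g a b).

(* I(f ; g | h) = H(f | h) - H(f | g, h). *)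
Definition cond_mutual_info (A B C : finType)
    (f : T -> A) (g : T -> B) (h : T -> C) : R :=
  cond_entropy f h - cond_entropy f (pair_rv g h).

End FiniteProbability.

Section Model.
Context {R : realType} {S1 S2 Sh1 Sh2 X Y1 Y2 : finType}.

(* [PY s1 s2 x (y1, y2)] is P(y1, y2 | s1, s2, x). *)
Context (PS : S1 * S2 -> R) (PY : S1 -> S2 -> X -> Y1 * Y2 -> R).
Context (d1 : S1 -> Sh1 -> R) (d2 : S2 -> Sh2 -> R).

(* The private randomness [rand] is an arbitrary probability space. The
   encoding map [enc i] receives the message, the list of past feedback
   symbols Z_1, ..., Z_{i-1} (see [channel_input]) and the private randomness. *)
Record code := Code {
  blen : nat;
  blen_gt0 : (0 < blen)%N;
  msg : finType;
  msg_gt0 : (0 < #|msg|)%N;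
  rand_disp : measure_display;
  rand : measurableType rand_disp;
  rand_law : probability rand R;
  enc : 'I_blen -> msg -> seq (Y1 * Y2) -> rand -> X;
  enc_measurable : forall i m z x, measurable [set w | enc i m z w = x];
  dec : blen.-tuple Y1 -> blen.-tuple S1 -> msg;
  est1 : blen.-tuple X -> blen.-tuple Y1 -> blen.-tuple Y2 -> blen.-tuple Sh1;
  est2 : blen.-tuple X -> blen.-tuple Y1 -> blen.-tuple Y2 -> blen.-tuple Sh2 }.

Section Block.
Context (c : code).

Definition block : Type :=
  (msg c * (blen c).-tuple X * (blen c).-tuple S1 * (blen c).-tuple S2 *
   (blen c).-tuple Y1 * (blen c).-tuple Y2)%type.

Definition bM (o : block) : msg c := let: (m, _, _, _, _, _) := o in m.
Definition bX (o : block) : (blen c).-tuple X := let: (_, x, _, _, _, _) := o in x.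
Definition bS1 (o : block) : (blen c).-tuple S1 := let: (_, _, s, _, _, _) := o in s.
Definition bS2 (o : block) : (blen c).-tuple S2 := let: (_, _, _, s, _, _) := o in s.
Definition bY1 (o : block) : (blen c).-tuple Y1 := let: (_, _, _, _, y, _) := o in y.
Definition bY2 (o : block) : (blen c).-tuple Y2 := let: (_, _, _, _, _, y) := o in y.

(* With indices starting at 0, input [i] uses the [i] previous outputs only. *)
Definition channel_input (m : msg c) (y1 : (blen c).-tuple Y1)
    (y2 : (blen c).-tuple Y2) (w : rand c) (i : 'I_(blen c)) : X :=
  enc i m (take i (zip y1 y2)) w.

(* Joint law of (M, X^n, S_1^n, S_2^n, Y_1^n, Y_2^n). The private randomness W,
   independent of the message, states and channel noise, is integrated out:
   the integral over W of the indicator that all inputs agree with x^n is the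
   probability of the event below. *)
Definition block_law (o : block) : R :=
  let: (m, x, s1, s2, y1, y2) := o in
  (#|msg c|%:R)^-1 *
  (\prod_(i < blen c) PS (tnth s1 i, tnth s2 i)) *
  fine (rand_law c [set w | forall i, channel_input m y1 y2 w i = tnth x i]) *
  \prod_(i < blen c)
     PY (tnth s1 i) (tnth s2 i) (tnth x i) (tnth y1 i, tnth y2 i).

Definition rate : R := ln (#|msg c|%:R) / (blen c)%:R.

Definition error_prob : R :=
  prob block_law [pred o | bM o != dec (bY1 o) (bS1 o)].

(* I(M ; Y_2^n | S_2^n) *)
Definition leakage : R := cond_mutual_info block_law bM bY2 bS2.

Definition block_distortion (S Sh : finType) (d : S -> Sh -> R)
    (s : (blen c).-tuple S) (sh : (blen c).-tuple Sh) : R :=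
  (blen c)%:R^-1 * \sum_(i < blen c) d (tnth s i) (tnth sh i).

Definition distortion1 : R :=
  expect block_law
    (fun o => block_distortion d1 (bS1 o) (est1 (bX o) (bY1 o) (bY2 o))).

Definition distortion2 : R :=
  expect block_law
    (fun o => block_distortion d2 (bS2 o) (est2 (bX o) (bY1 o) (bY2 o))).

End Block.

Definition achievable (t : R * R * R) : Prop :=
  let: (r, D1, D2) := t in
  0 <= r /\
  forall delta : R, 0 < delta ->
    exists c : code,
      [/\ r - delta <= rate c,
          error_prob c <= delta,
          leakage c <= delta,
          distortion1 c <= D1 + delta &
          distortion2 c <= D2 + delta].

Definition region_POF : set (R * R * R) := closure [set t | achievable t].

Definition letter : Type := (X * S1 * S2 * Y1 * Y2)%type.

Definition lX (o : letter) : X := let: (x, _, _, _, _) := o in x.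
Definition lS1 (o : letter) : S1 := let: (_, s, _, _, _) := o in s.
Definition lS2 (o : letter) : S2 := let: (_, _, s, _, _) := o in s.
Definition lY1 (o : letter) : Y1 := let: (_, _, _, y, _) := o in y.
Definition lY2 (o : letter) : Y2 := let: (_, _, _, _, y) := o in y.

Definition letter_law (PX : X -> R) (o : letter) : R :=
  let: (x, s1, s2, y1, y2) := o in PX x * PS (s1, s2) * PY s1 s2 x (y1, y2).

(* The element [t0] witnesses that the reconstruction alphabet is nonempty. *)
Definition bayes_est (S Sh : finType) (t0 : Sh) (d : S -> Sh -> R)
    (lS : letter -> S) (PX : X -> R) (x : X) (y1 : Y1) (y2 : Y2) : Sh :=
  [arg min_(t < t0)
     \sum_s cond_law (letter_law PX) lS
              (pair_rv lX (pair_rv lY1 lY2)) s (x, (y1, y2)) * d s t]%O.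

Definition outer_region (t1 : Sh1) (t2 : Sh2) (PX : X -> R)
    : set (R * R * R) :=
  [set t | let: (r, D1, D2) := t in
    let P := letter_law PX in
    [/\ 0 <= r,
        expect P (fun o =>
          d1 (lS1 o) (bayes_est t1 d1 lS1 PX (lX o) (lY1 o) (lY2 o))) <= D1,
        expect P (fun o =>
          d2 (lS2 o) (bayes_est t2 d2 lS2 PX (lX o) (lY1 o) (lY2 o))) <= D2 &
        r <= Num.min
          (cond_entropy P (pair_rv lY1 lS1) (pair_rv lY2 lS2)
             - cond_entropy P lS1 (pair_rv (pair_rv lY1 lY2) (pair_rv lS2 lX)))
          (cond_mutual_info P lX lY1 lS1)]].

End Model.

(* Main.v *)
(* Write PX for the average over i of the laws of the inputs X_i and L for the
   single-letter law it induces, so that n times an L-expectation is the sum of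
   the expectations of the n letters of the block. Both rate bounds come
   from one application of [E ln Z <= 0] for [E Z <= 1], without any chain rule:
   with q the Fano kernel, i.e. mass 1 - e on the decoded message and mass e
   spread uniformly, take
     Z = q(M | Y1^n, S1^n) / P(M | Y2^n, S2^n)
           * prod_i L(y1, s1 | y2, s2) / L(s1 | y1, y2, s2, x)
   for the secrecy bound and
     Z = |M| q(M | Y1^n, S1^n) * prod_i L(x | s1) / L(x | y1, s1)
   for the reliability bound. That [E Z <= 1] is a causal summation, letter by
   letter, since the i-th input depends only on the previous outputs. The
   distortion of the best single-letter estimator is linear in PX. Letting the
   slack tend to 0, compactness of the simplex of input laws and continuity of
   x ln x yield one input law satisfying all the bounds. *)

Require Import Defs.
From HB Require Import structures.
From mathcomp Require Import all_boot all_order all_algebra.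
From mathcomp Require Import all_classical all_reals all_analysis.
From mathcomp Require Import measurable_realfun ring lra.

Import Order.TTheory GRing.Theory Num.Theory numFieldNormedType.Exports.
Local Open Scope classical_set_scope.
Local Open Scope ring_scope.

Set Implicit Arguments.
Unset Strict Implicit.
Unset Printing Implicit Defensive.

(** * Laws and entropies on finite spaces *)

Lemma ln_le_subr1 (R : realType) (x : R) : 0 < x -> ln x <= x - 1.
Proof.
move=> x0; have := @le_ln1Dx R (x - 1); rewrite [1 + _]addrC subrK; apply.
by rewrite ltrBrDl subrr.
Qed.

Section FiniteLaws.
Variables (R : realType) (T : finType) (P : T -> R).
Hypothesis P_ge0 : forall w, 0 <= P w.

Lemma prob_ge0 (E : pred T) : 0 <= prob P E.
Proof. exact: sumr_ge0. Qed.

Lemma law_ge0 (A : finType) (f : T -> A) a : 0 <= law P f a.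
Proof. exact: prob_ge0. Qed.

Lemma law_gt0 (A : finType) (f : T -> A) w : 0 < P w -> 0 < law P f (f w).
Proof.
move=> Pw; rewrite /law /prob (bigD1 w) //= ltr_wpDr //.
exact: sumr_ge0.
Qed.

Lemma law_sum (A : finType) (f : T -> A) a :
  law P f a = \sum_w P w * (f w == a)%:R.
Proof.
by rewrite /law /prob big_mkcond; apply: eq_bigr => w _ /=; case: eqP; rewrite (mulr1, mulr0).
Qed.

Lemma sum_law (A : finType) (f : T -> A) (F : A -> R) :
  \sum_a law P f a * F a = \sum_w P w * F (f w).
Proof.
rewrite [RHS](partition_big f predT) //=; apply: eq_bigr => a _.
by rewrite /law /prob mulr_suml; apply: eq_bigr => w /eqP ->.
Qed.

Lemma sum_law1 (A : finType) (f : T -> A) : \sum_a law P f a = \sum_w P w.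
Proof.
have := sum_law f (fun _ => 1).
by under eq_bigr do rewrite mulr1; under [RHS]eq_bigr do rewrite mulr1.
Qed.

Section Pairs.
Variables (A B : finType) (f : T -> A) (g : T -> B).

Lemma sum_law_pairl b : \sum_a law P (pair_rv f g) (a, b) = law P g b.
Proof.
rewrite /law /prob [RHS](partition_big f predT) //=; apply: eq_bigr => a _.
by apply: eq_bigl => w; rewrite /= xpair_eqE andbC.
Qed.

Lemma law_pair_ler a b : law P (pair_rv f g) (a, b) <= law P g b.
Proof.
rewrite -sum_law_pairl (bigD1 a) //= lerDl; apply: sumr_ge0 => *.
exact: law_ge0.
Qed.

Lemma cond_law_ge0 a b : 0 <= cond_law P f g a b.
Proof. by rewrite divr_ge0 // law_ge0. Qed.

Lemma cond_law_gt0 w : 0 < P w -> 0 < cond_law P f g (f w) (g w).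
Proof. by move=> Pw; rewrite divr_gt0 ?law_gt0 // (law_gt0 (pair_rv f g)). Qed.

Lemma sum_cond_law_le1 b : \sum_a cond_law P f g a b <= 1.
Proof.
rewrite /cond_law -mulr_suml sum_law_pairl.
by have [->|/divff->//] := eqVneq (law P g b) 0; rewrite mul0r.
Qed.

Lemma mul_law_cond a b : law P g b * cond_law P f g a b = law P (pair_rv f g) (a, b).
Proof.
rewrite /cond_law; have [g0|g0] := eqVneq (law P g b) 0; last by rewrite mulrCA divff ?mulr1.
rewrite g0 mul0r; apply/esym/eqP; rewrite eq_le law_ge0 andbT -g0.
exact: law_pair_ler.
Qed.

(** As an expectation over the sample space, an entropy can be compared with the logarithm of a
    density point by point. *)
Lemma cond_entropyE :
  cond_entropy P f g = - \sum_w P w * ln (cond_law P f g (f w) (g w)).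
Proof.
rewrite /cond_entropy; congr (- _).
rewrite (pair_bigA _ (fun a b => law P (pair_rv f g) (a, b) * ln (cond_law P f g a b))) /=.
have /= <- := sum_law (pair_rv f g) (fun p => ln (cond_law P f g p.1 p.2)).
by apply: eq_bigr => -[].
Qed.

(** This is H(f, g) - H(g). No quotient is left, so the expression stays continuous in [P] even
    where a conditioning event has mass 0. *)
Lemma cond_entropy_xlnx :
  cond_entropy P f g = \sum_b (law P g b * ln (law P g b))
   - \sum_p (law P (pair_rv f g) p * ln (law P (pair_rv f g) p)).
Proof.
rewrite cond_entropyE sum_law (sum_law _ (fun p => ln (law P (pair_rv f g) p))).
rewrite -sumrB -sumrN; apply: eq_bigr => w _.
have [->|Pw] := eqVneq (P w) 0; first by rewrite !mul0r subrr oppr0.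
have {}Pw : 0 < P w by rewrite lt_neqAle eq_sym Pw P_ge0.
rewrite ln_div ?posrE ?law_gt0 ?(law_gt0 (pair_rv f g)) //.
by rewrite -mulrBr -mulrN opprB.
Qed.

(** Conditioning on [g] splits the expectation into one nonnegatively weighted term per value of
    [g], and [e] minimizes each term separately. *)
Lemma expect_cond_argmin (Sh : finType) (d : A -> Sh -> R) (e e' : B -> Sh) :
  (forall b t, \sum_a cond_law P f g a b * d a (e b)
                 <= \sum_a cond_law P f g a b * d a t) ->
  expect P (fun w => d (f w) (e (g w))) <= expect P (fun w => d (f w) (e' (g w))).
Proof.
move=> emin.
have E (e0 : B -> Sh) : expect P (fun w => d (f w) (e0 (g w)))
   = \sum_b law P g b * \sum_a cond_law P f g a b * d a (e0 b).
  rewrite /expect; have /= <- := sum_law (pair_rv f g) (fun p => d p.1 (e0 p.2)).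
  rewrite -(pair_bigA _ (fun a b => law P (pair_rv f g) (a, b) * d a (e0 b))) /=.
  rewrite exchange_big; apply: eq_bigr => b _; rewrite mulr_sumr.
  by apply: eq_bigr => a _; rewrite mulrA mul_law_cond.
by rewrite !E; apply: ler_sum => b _; rewrite ler_wpM2l ?law_ge0.
Qed.

End Pairs.

(** Jensen's inequality for the logarithm, through ln z <= z - 1. Points of mass 0 contribute
    nothing, so [Z] need be positive only where [P] is. *)
Lemma expect_ln_le0 (Z : T -> R) : \sum_w P w = 1 ->
  (forall w, 0 < P w -> 0 < Z w) -> \sum_w P w * Z w <= 1 ->
  \sum_w P w * ln (Z w) <= 0.
Proof.
move=> P1 Z0 PZ.
apply: (@le_trans _ _ (\sum_w (P w * Z w - P w))); last first.
  by rewrite sumrB P1 subr_le0.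
apply: ler_sum => w _.
have [->|Pw] := eqVneq (P w) 0; first by rewrite !mul0r subrr.
have {}Pw : 0 < P w by rewrite lt_neqAle eq_sym Pw P_ge0.
rewrite -[X in _ - X]mulr1 -mulrBr ler_wpM2l //.
exact/ln_le_subr1/Z0.
Qed.

End FiniteLaws.

(** * Sums over causal sequences *)

Section TupleSums.
Variable R : realType.

Lemma sum_pair (A B : finType) (F : A * B -> R) : \sum_p F p = \sum_a \sum_b F (a, b).
Proof. by rewrite (pair_bigA _ (fun a b => F (a, b))); apply: eq_bigr => -[]. Qed.

Lemma sum_tuple_cons (T : finType) n (F : n.+1.-tuple T -> R) :
  \sum_t F t = \sum_a \sum_(t : n.-tuple T) F [tuple of a :: t].
Proof.
rewrite (pair_bigA _ (fun a (t : n.-tuple T) => F [tuple of a :: t])) /=.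
rewrite (reindex (fun p : T * n.-tuple T => [tuple of p.1 :: p.2])) //=.
exists (fun t : n.+1.-tuple T => (thead t, [tuple of behead t])) => [[a t] _|t _] /=.
  by congr pair; apply: val_inj.
by rewrite [t in RHS]tuple_eta.
Qed.

Lemma sum_tuple_prod (T : finType) n (F : 'I_n -> T -> R) :
  \sum_(t : n.-tuple T) \prod_i F i (tnth t i) = \prod_i \sum_a F i a.
Proof.
elim: n F => [|n IH] F.
  rewrite big_ord0 (eq_bigr (fun _ => 1)) => [|t _]; last by rewrite big_ord0.
  by rewrite sumr_const card_tuple expn0.
rewrite sum_tuple_cons big_ord_recl mulr_suml; apply: eq_bigr => a _.
rewrite -IH mulr_sumr; apply: eq_bigr => t _.
by rewrite big_ord_recl tnth0; congr *%R; apply: eq_bigr => i _; rewrite tnthS.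
Qed.

Lemma sum_tuple_prod_at (T : finType) n (F : 'I_n -> T -> R) (g : T -> R) i :
  \sum_(t : n.-tuple T) (\prod_j F j (tnth t j)) * g (tnth t i)
    = (\prod_(j | j != i) \sum_a F j a) * \sum_a F i a * g a.
Proof.
transitivity (\prod_j \sum_a F j a * (if j == i then g a else 1)); last first.
  rewrite (bigD1 i) //= eqxx mulrC; congr (_ * _); apply: eq_bigr => j /negPf ->.
  by apply: eq_bigr => a _; rewrite mulr1.
rewrite -sum_tuple_prod; apply: eq_bigr => t _; rewrite big_split /=; congr (_ * _).
by rewrite (bigD1 i) //= eqxx big1 ?mulr1 // => j /negPf ->.
Qed.

Definition zipt {A B : Type} {n} (a : n.-tuple A) (b : n.-tuple B) : n.-tuple (A * B) :=
  [tuple of zip a b].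

Lemma tnth_zipt (A B : Type) n (a : n.-tuple A) (b : n.-tuple B) i :
  tnth (zipt a b) i = (tnth a i, tnth b i).
Proof.
by rewrite (tnth_nth (tnth a i, tnth b i)) /= nth_zip ?size_tuple // -!tnth_nth.
Qed.

Lemma sum_zipt (A B : finType) n (F : n.-tuple (A * B) -> R) :
  \sum_t F t = \sum_a \sum_b F (zipt a b).
Proof.
rewrite (pair_bigA _ (fun a b => F (zipt a b))) /=.
rewrite (reindex (fun p : n.-tuple A * n.-tuple B => zipt p.1 p.2)) //=.
exists (fun t : n.-tuple (A * B) => (map_tuple fst t, map_tuple snd t)) => [[a b] _|t _] /=.
  by congr pair; apply: eq_from_tnth => i; rewrite tnth_map tnth_zipt.
by apply: eq_from_tnth => i; rewrite tnth_zipt !tnth_map; case: (tnth t i).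
Qed.

End TupleSums.

Lemma take_zip (A B : Type) i (a : seq A) (b : seq B) :
  take i (zip a b) = zip (take i a) (take i b).
Proof. by elim: i a b => [|i IH] [|x a] [|y b] //=; rewrite ?zip0s ?zips0 // IH. Qed.

Section CausalSums.
Variables (R : realType) (Z X : finType).

(* [f i] sees the letters before [i] only: summing out the letters from the last
   one backwards, every factor contributes 1. *)
Lemma sum_causal n (f : 'I_n -> seq Z -> X) (K : 'I_n -> X -> Z -> R) :
  (forall i x, \sum_z K i x z = 1) ->
  \sum_(t : n.-tuple Z) \prod_i K i (f i (take i t)) (tnth t i) = 1.
Proof.
elim: n f K => [|n IH] f K K1.
  rewrite (eq_bigr (fun _ => 1)) => [|t _]; last by rewrite big_ord0.
  by rewrite sumr_const card_tuple expn0.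
rewrite sum_tuple_cons -[RHS](K1 ord0 (f ord0 [::])); apply: eq_bigr => a _.
rewrite -[RHS]mulr1.
rewrite -[X in _ = _ * X](IH (fun i s => f (lift ord0 i) (a :: s))
  (fun i => K (lift ord0 i))) //.
rewrite mulr_sumr; apply: eq_bigr => t _; rewrite big_ord_recl tnth0 take0.
by congr *%R; apply: eq_bigr => i _; rewrite tnthS.
Qed.

(** The substochastic variant serves kernels obtained by normalizing a sum that may vanish.
    Multiplying inequalities requires nonnegative factors. *)
Lemma sum_causal_le n (f : 'I_n -> seq Z -> X) (K : 'I_n -> X -> Z -> R) :
  (forall i x z, 0 <= K i x z) -> (forall i x, \sum_z K i x z <= 1) ->
  \sum_(t : n.-tuple Z) \prod_i K i (f i (take i t)) (tnth t i) <= 1.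
Proof.
elim: n f K => [|n IH] f K K0 K1.
  rewrite (eq_bigr (fun _ => 1)) => [|t _]; last by rewrite big_ord0.
  by rewrite sumr_const card_tuple expn0.
rewrite sum_tuple_cons; apply: le_trans (K1 ord0 (f ord0 [::])); apply: ler_sum => a _.
rewrite -[leRHS]mulr1.
apply: le_trans (ler_wpM2l _ (IH (fun i s => f (lift ord0 i) (a :: s))
  (fun i => K (lift ord0 i)) _ _)) => //.
rewrite mulr_sumr; apply: ler_sum => t _; rewrite big_ord_recl tnth0 take0.
rewrite le_eqVlt; apply/orP; left; apply/eqP; congr *%R.
by apply: eq_bigr => i _; rewrite tnthS.
Qed.

(** The letters after [i0] sum out to 1, so letter [i0] may be replaced by its conditional mean
    given its input, which depends on the past alone. *)
Lemma sum_causal_letter n (f : 'I_n -> seq Z -> X) (K : 'I_n -> X -> Z -> R)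
    (h : X -> Z -> R) (i0 : 'I_n) :
  (forall i x, \sum_z K i x z = 1) ->
  \sum_(t : n.-tuple Z) (\prod_i K i (f i (take i t)) (tnth t i)) *
     h (f i0 (take i0 t)) (tnth t i0) =
  \sum_(t : n.-tuple Z) (\prod_i K i (f i (take i t)) (tnth t i)) *
     \sum_z K i0 (f i0 (take i0 t)) z * h (f i0 (take i0 t)) z.
Proof.
elim: n f K i0 => [|n IH] f K i0 K1; first by case: i0.
have E (a : Z) (t : n.-tuple Z) :
    \prod_i K i (f i (take i [tuple of a :: t])) (tnth [tuple of a :: t] i) =
    K ord0 (f ord0 [::]) a *
    \prod_i K (lift ord0 i) (f (lift ord0 i) (a :: take i t)) (tnth t i).
  rewrite big_ord_recl tnth0 take0; congr *%R.
  by apply: eq_bigr => i _; rewrite tnthS.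
rewrite !sum_tuple_cons.
(* If [i0] is not the head, the head letter joins the history and the induction hypothesis applies.
   If it is the head, the whole tail sums out to 1. *)
case: (unliftP ord0 i0) => [i ->|->].
  apply: eq_bigr => a _.
  under eq_bigr do rewrite E tnthS -mulrA.
  under [RHS]eq_bigr do rewrite E -mulrA.
  rewrite -!mulr_sumr; congr *%R.
  exact: (IH (fun i s => f (lift ord0 i) (a :: s)) (fun i => K (lift ord0 i))).
have S1 (a : Z) : \sum_(t : n.-tuple Z)
   \prod_i K (lift ord0 i) (f (lift ord0 i) (a :: take i t)) (tnth t i) = 1.
  exact: (@sum_causal n (fun i s => f (lift ord0 i) (a :: s)) (fun i => K (lift ord0 i))).
under eq_bigr => a _.
  under eq_bigr do rewrite E tnth0 take0 mulrAC.
  rewrite -mulr_sumr S1 mulr1; over.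
under [RHS]eq_bigr => a _.
  under eq_bigr do rewrite E take0 mulrAC.
  rewrite -mulr_sumr S1 mulr1; over.
by rewrite -mulr_suml K1 mul1r.
Qed.

End CausalSums.

(** * Integrating out the private randomness *)

Section FiniteSumsOfMeasures.
Variables (R : realType) (d : measure_display) (W : measurableType d).
Variables (mu : probability W R) (I : finType) (A : I -> set W) (c : I -> R).
Hypotheses (mA : forall i, measurable (A i)) (c_ge0 : forall i, 0 <= c i).

Lemma sum_fine_measure :
  ((\sum_i c i * fine (mu (A i)))%:E
    = \int[mu]_w (\sum_i c i * \1_(A i) w)%:E)%E.
Proof.
under eq_integral do rewrite -sumEFin.
rewrite ge0_integral_sum //.
- rewrite -sumEFin; apply: eq_bigr => i _.
  under eq_integral do rewrite EFinM.
  rewrite ge0_integralZl_EFin //.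
  + by rewrite integral_indic // setIT EFinM fineK ?fin_num_measure.
  + by apply/measurable_EFinP; exact: measurable_indic.
- by move=> i; apply/measurable_EFinP; apply: measurable_funM.
- by move=> i w _; rewrite lee_fin mulr_ge0.
Qed.

End FiniteSumsOfMeasures.

Section CausalMeasures.
Variables (R : realType) (d : measure_display) (W : measurableType d).
Variables (mu : probability W R) (X Z : finType) (n : nat).

Lemma integral_prob1 : (\int[mu]_w 1 = 1)%E.
Proof. by rewrite integral_cst //= mul1e; exact: probability_setT. Qed.

Variable f : 'I_n -> seq Z -> W -> X.
Hypothesis mf : forall i s x, measurable [set w | f i s w = x].

Definition input_event (x : n.-tuple X) (z : n.-tuple Z) : set W :=
  [set w | forall i, f i (take i z) w = tnth x i].

Definition input_prob (x : n.-tuple X) (z : n.-tuple Z) : R :=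
  fine (mu (input_event x z)).

Lemma measurable_inputs (x : n.-tuple X) (z : n.-tuple Z) :
  measurable (input_event x z).
Proof.
rewrite (_ : input_event x z = \bigcap_(i in [set: 'I_n]) [set w | f i (take i z) w = tnth x i]).
  apply: fin_bigcap_measurable => //.
by apply/seteqP; split=> w /= h i; [move=> _|]; exact: h.
Qed.

(** Once the randomness [w] is fixed, the inputs are a deterministic causal function of [z], so a
    single [x] survives in the sum. Probabilistic encoders thereby reduce to the deterministic
    causal sums above, integrated over [w]. *)
Lemma sum_input_prob (g : n.-tuple X -> n.-tuple Z -> R) :
  (forall x z, 0 <= g x z) ->
  ((\sum_(x : n.-tuple X) \sum_(z : n.-tuple Z) g x z * input_prob x z)%:E
    = \int[mu]_w (\sum_(z : n.-tuple Z) g [tuple f i (take i z) w | i < n] z)%:E)%E.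
Proof.
move=> g0; rewrite (pair_bigA _ (fun x z => g x z * input_prob x z)) /=.
rewrite (@sum_fine_measure _ _ _ mu _
  (fun p => input_event p.1 p.2) (fun p => g p.1 p.2)) //; last first.
  by move=> p; exact: measurable_inputs.
apply: eq_integral => w _; congr EFin.
rewrite -(pair_bigA _ (fun x z =>
  g x z * \1_(input_event x z) w)) /= exchange_big.
apply: eq_bigr => z _.
rewrite (bigD1 [tuple f i (take i z) w | i < n]) //= [X in _ + X]big1 ?addr0.
  by rewrite indicE mem_set ?mulr1 //= => i; rewrite tnth_mktuple.
move=> x xn; rewrite indicE memNset ?mulr0 //= => h.
by case/eqP: xn; apply: eq_from_tnth => i; rewrite tnth_mktuple h.
Qed.

Variable K : 'I_n -> X -> Z -> R.
Hypothesis K_ge0 : forall i x z, 0 <= K i x z.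

Lemma sum_input_kernel_le : (forall i x, \sum_z K i x z <= 1) ->
  \sum_(x : n.-tuple X) \sum_(z : n.-tuple Z) (\prod_i K i (tnth x i) (tnth z i)) * input_prob x z <= 1.
Proof.
move=> K1; rewrite -lee_fin sum_input_prob; last by move=> x z; exact: prodr_ge0.
rewrite -integral_prob1.
apply: ge0_le_integral => //.
- by move=> w _; rewrite lee_fin sumr_ge0 // => z _; exact: prodr_ge0.
(* Measurability is read off the equivalent form of the integrand as a finite combination of
   indicators of input events. *)
- apply/measurable_EFinP.
  rewrite (_ : (fun w => _) = (fun w =>
     \sum_(x : n.-tuple X) \sum_(z : n.-tuple Z) (\prod_i K i (tnth x i) (tnth z i)) *
     \1_(input_event x z) w)).
    apply: measurable_sum => x; apply: measurable_sum => z; apply: measurable_funM => //.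
    apply: measurable_indic; exact: measurable_inputs.
  apply/funext => w; rewrite exchange_big; apply: eq_bigr => z _.
  rewrite (bigD1 [tuple f i (take i z) w | i < n]) //= [X in _ + X]big1 ?addr0.
    by rewrite indicE mem_set ?mulr1 //= => i; rewrite tnth_mktuple.
  move=> x xn; rewrite indicE memNset ?mulr0 //= => h.
  by case/eqP: xn; apply: eq_from_tnth => i; rewrite tnth_mktuple h.
- move=> w _; rewrite lee_fin.
  apply: le_trans (@sum_causal_le _ _ _ _ (fun i s => f i s w) _ K_ge0 K1).
  rewrite le_eqVlt; apply/orP; left; apply/eqP; apply: eq_bigr => z _; apply: eq_bigr => i _.
  by rewrite tnth_mktuple.
Qed.

Lemma sum_input_kernel : (forall i x, \sum_z K i x z = 1) ->
  \sum_(x : n.-tuple X) \sum_(z : n.-tuple Z) (\prod_i K i (tnth x i) (tnth z i)) * input_prob x z = 1.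
Proof.
move=> K1; apply: EFin_inj; rewrite sum_input_prob; last by move=> x z; exact: prodr_ge0.
rewrite -[RHS]integral_prob1.
apply: eq_integral => w _; congr EFin.
rewrite -[RHS](@sum_causal _ _ _ _ (fun i s => f i s w) _ K1).
by apply: eq_bigr => z _; apply: eq_bigr => i _; rewrite tnth_mktuple.
Qed.

Lemma sum_input_letter (h : X -> Z -> R) i0 :
  (forall x z, 0 <= h x z) -> (forall i x, \sum_z K i x z = 1) ->
  \sum_(x : n.-tuple X) \sum_(z : n.-tuple Z) (\prod_i K i (tnth x i) (tnth z i)) * h (tnth x i0) (tnth z i0) *
    input_prob x z =
  \sum_(x : n.-tuple X) \sum_(z : n.-tuple Z) (\prod_i K i (tnth x i) (tnth z i)) *
    (\sum_u K i0 (tnth x i0) u * h (tnth x i0) u) * input_prob x z.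
Proof.
move=> h0 K1; apply: EFin_inj; rewrite !sum_input_prob; first last.
- by move=> x z; rewrite mulr_ge0 ?prodr_ge0.
- by move=> x z; rewrite mulr_ge0 ?prodr_ge0 ?sumr_ge0 // => u _; rewrite mulr_ge0.
apply: eq_integral => w _; congr EFin.
have E (z : n.-tuple Z) :
   \prod_i K i (tnth [tuple f i0 (take i0 z) w | i0 < n] i) (tnth z i) =
   \prod_i K i (f i (take i z) w) (tnth z i).
  by apply: eq_bigr => i _; rewrite tnth_mktuple.
under [LHS]eq_bigr do rewrite E tnth_mktuple.
under [RHS]eq_bigr do rewrite E tnth_mktuple.
exact: (@sum_causal_letter _ _ _ _ (fun i s => f i s w)).
Qed.

End CausalMeasures.

(** * The single-letter law *)

Section LetterKernels.
Variables (R : realType) (S1 S2 X Y1 Y2 : finType).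
Variables (PS : S1 * S2 -> R) (PY : S1 -> S2 -> X -> Y1 * Y2 -> R).
Hypotheses (hPS : is_pmf PS) (hPY : forall s1 s2 x, is_pmf (PY s1 s2 x)).

(** The kernel P(s1, s2, y1, y2 | x). The states are independent of the input, so it is the same for
    every input law. *)
Definition chan (x : X) (s1 : S1) (s2 : S2) (y1 : Y1) (y2 : Y2) : R :=
  PS (s1, s2) * PY s1 s2 x (y1, y2).

Definition chan_s1y1 (x : X) (s1 : S1) (y1 : Y1) : R :=
  \sum_s2 \sum_y2 chan x s1 s2 y1 y2.

Definition chan_y1y2s2 (x : X) (y1 : Y1) (y2 : Y2) (s2 : S2) : R :=
  \sum_s1 chan x s1 s2 y1 y2.

Lemma PS_ge0 s : 0 <= PS s. Proof. by case: hPS. Qed.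
Lemma PY_ge0 s1 s2 x y : 0 <= PY s1 s2 x y. Proof. by case: (hPY s1 s2 x). Qed.

Lemma chan_ge0 x s1 s2 y1 y2 : 0 <= chan x s1 s2 y1 y2.
Proof. by rewrite mulr_ge0 ?PS_ge0 ?PY_ge0. Qed.

Lemma chan_s1y1_ge0 x s1 y1 : 0 <= chan_s1y1 x s1 y1.
Proof. by apply: sumr_ge0 => s2 _; apply: sumr_ge0 => y2 _; exact: chan_ge0. Qed.

Lemma chan_y1y2s2_ge0 x y1 y2 s2 : 0 <= chan_y1y2s2 x y1 y2 s2.
Proof. by apply: sumr_ge0 => s1 _; exact: chan_ge0. Qed.

Lemma chan_le_s1y1 x s1 s2 y1 y2 : chan x s1 s2 y1 y2 <= chan_s1y1 x s1 y1.
Proof.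
rewrite /chan_s1y1 (bigD1 s2) //= (bigD1 y2) //= -addrA lerDl.
by rewrite addr_ge0 ?sumr_ge0 // => *; rewrite ?sumr_ge0 // => *; exact: chan_ge0.
Qed.

Lemma chan_le_y1y2s2 x s1 s2 y1 y2 : chan x s1 s2 y1 y2 <= chan_y1y2s2 x y1 y2 s2.
Proof.
rewrite /chan_y1y2s2 (bigD1 s1) //= lerDl.
by rewrite sumr_ge0 // => *; exact: chan_ge0.
Qed.

Lemma sum_PY s1 s2 x : \sum_y1 \sum_y2 PY s1 s2 x (y1, y2) = 1.
Proof.
rewrite (pair_bigA _ (fun y1 y2 => PY s1 s2 x (y1, y2))) /=.
by have [_ <-] := hPY s1 s2 x; apply: eq_bigr => -[].
Qed.

Lemma sum_chan_y x s1 s2 : \sum_y1 \sum_y2 chan x s1 s2 y1 y2 = PS (s1, s2).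
Proof.
rewrite -[RHS]mulr1 -(sum_PY s1 s2 x) mulr_sumr; apply: eq_bigr => y1 _.
by rewrite mulr_sumr.
Qed.

Lemma sum_PS : \sum_s1 \sum_s2 PS (s1, s2) = 1.
Proof.
rewrite (pair_bigA _ (fun s1 s2 => PS (s1, s2))) /=.
by have [_ <-] := hPS; apply: eq_bigr => -[].
Qed.

Lemma sum_letter (F : letter -> R) :
  \sum_o F o = \sum_x \sum_s1 \sum_s2 \sum_y1 \sum_(y2 : Y2) F (x : X, s1 : S1, s2 : S2, y1 : Y1, y2).
Proof.
by rewrite -[LHS]/(\sum_(p : X * S1 * S2 * Y1 * Y2) F p) !sum_pair.
Qed.

Variable PX : X -> R.
Hypothesis hPX : is_pmf PX.

Let L : letter -> R := letter_law PS PY PX.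

Lemma letter_lawE x s1 s2 y1 y2 : L (x, s1, s2, y1, y2) = PX x * chan x s1 s2 y1 y2.
Proof. by rewrite /L /= mulrA. Qed.

Lemma letter_law_ge0 o : 0 <= L o.
Proof.
by case: hPX => PX0 _; case: o => [[[[x s1] s2] y1] y2]; rewrite letter_lawE mulr_ge0 ?chan_ge0.
Qed.

Lemma sum_letter_law : \sum_o L o = 1.
Proof.
rewrite sum_letter; case: hPX => _ <-; apply: eq_bigr => x _.
rewrite -[RHS]mulr1 -sum_PS mulr_sumr; apply: eq_bigr => s1 _.
rewrite mulr_sumr; apply: eq_bigr => s2 _; rewrite -(sum_chan_y x) mulr_sumr.
apply: eq_bigr => y1 _; rewrite mulr_sumr; apply: eq_bigr => y2 _.
exact: letter_lawE.
Qed.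

Lemma law_x_y1s1 x y1 s1 :
  law L (pair_rv lX (pair_rv lY1 lS1)) (x, (y1, s1)) = PX x * chan_s1y1 x s1 y1.
Proof.
rewrite /law /prob (reindex (fun p : S2 * Y2 => (x, s1, p.1, y1, p.2))) /=; last first.
  exists (fun o => (lS2 o, lY2 o)) => [[s2 y2] //|[[[[x' s1'] s2] y1'] y2]].
  by rewrite inE => /eqP[-> -> ->].
under eq_bigl do rewrite eqxx.
rewrite sum_pair /chan_s1y1 mulr_sumr; apply: eq_bigr => s2 _.
by rewrite mulr_sumr; apply: eq_bigr => y2 _; rewrite mulrA.
Qed.

Lemma law_x_s1 x s1 : law L (pair_rv lX lS1) (x, s1) = PX x * \sum_s2 PS (s1, s2).
Proof.
rewrite /law /prob (reindex (fun p : S2 * (Y1 * Y2) => (x, s1, p.1, p.2.1, p.2.2))) /=; last first.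
  exists (fun o => (lS2 o, (lY1 o, lY2 o))) => [[s2 [y1 y2]] //|[[[[x' s1'] s2] y1] y2]].
  by rewrite inE => /eqP[-> ->].
under eq_bigl do rewrite eqxx.
rewrite sum_pair mulr_sumr; apply: eq_bigr => s2 _.
rewrite sum_pair -[PS _ in RHS](sum_chan_y x) mulr_sumr; apply: eq_bigr => y1 _.
by rewrite mulr_sumr; apply: eq_bigr => y2 _; rewrite mulrA.
Qed.

Lemma law_s1 s1 : law L lS1 s1 = \sum_s2 PS (s1, s2).
Proof.
rewrite -(sum_law_pairl _ lX); under eq_bigr do rewrite law_x_s1.
by rewrite -mulr_suml; case: hPX => _ ->; rewrite mul1r.
Qed.

Lemma law_s1_y1y2s2x x s1 s2 y1 y2 :
  law L (pair_rv lS1 (pair_rv (pair_rv lY1 lY2) (pair_rv lS2 lX))) (s1, ((y1, y2), (s2, x)))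
    = PX x * chan x s1 s2 y1 y2.
Proof.
rewrite -letter_lawE /law /prob (big_pred1 (x, s1, s2, y1, y2)) // => -[[[[x' s1'] s2'] y1'] y2'].
by apply/eqP/eqP => [[-> -> -> -> ->]|[-> -> -> -> ->]].
Qed.

Lemma law_y1y2s2x x s2 y1 y2 :
  law L (pair_rv (pair_rv lY1 lY2) (pair_rv lS2 lX)) ((y1, y2), (s2, x))
    = PX x * chan_y1y2s2 x y1 y2 s2.
Proof.
rewrite -(sum_law_pairl _ lS1); under eq_bigr do rewrite law_s1_y1y2s2x.
by rewrite -mulr_sumr.
Qed.

(* The information density of [I(X; Y1 | S1)]. *)
Lemma cond_law_x_ratio x s1 s2 y1 y2 : 0 < L (x, s1, s2, y1, y2) ->
  cond_law L lX lS1 x s1 / cond_law L lX (pair_rv lY1 lS1) x (y1, s1)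
    = law L (pair_rv lY1 lS1) (y1, s1) / chan_s1y1 x s1 y1.
Proof.
move=> Lgt0; rewrite /cond_law law_x_y1s1 law_x_s1 law_s1.
have := Lgt0; rewrite letter_lawE.
have := chan_le_s1y1 x s1 s2 y1 y2.
have := law_gt0 letter_law_ge0 lS1 Lgt0.
have := law_gt0 letter_law_ge0 (pair_rv lY1 lS1) Lgt0; rewrite law_s1 /= /pair_rv /=.
have [PX0 _] := hPX; have := PX0 x.
have := chan_ge0 x s1 s2 y1 y2.
set c := chan _ _ _ _ _; set c' := chan_s1y1 _ _ _; set p := \sum_s2 _; set q := law _ _ _.
move=> c0 px0 q0 p0 cc' pc.
have pxn0 : PX x != 0 by apply: contraTneq pc => ->; rewrite mul0r ltxx.
have cn0 : c' != 0.
  apply: contraTneq pc => c'0; rewrite c'0 in cc'.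
  by rewrite -leNgt mulr_ge0_le0.
field; rewrite cn0 pxn0 !gt_eqF //.
Qed.

(** The factor [PX x] cancels, and positivity of the mass excludes [PX x = 0]. The posterior of S1
    given X and the other letters thus does not depend on the input law. *)
Lemma cond_law_s1 x s1 s2 y1 y2 : 0 < L (x, s1, s2, y1, y2) ->
  cond_law L lS1 (pair_rv (pair_rv lY1 lY2) (pair_rv lS2 lX)) s1 ((y1, y2), (s2, x))
    = chan x s1 s2 y1 y2 / chan_y1y2s2 x y1 y2 s2.
Proof.
rewrite letter_lawE /cond_law law_s1_y1y2s2x law_y1y2s2x => Lgt0.
rewrite -mulf_div divff ?mul1r //.
by apply: contraTneq Lgt0 => ->; rewrite mul0r ltxx.
Qed.

End LetterKernels.

(** * The law of a block *)

Section BlockLaw.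
Variables (R : realType) (S1 S2 Sh1 Sh2 X Y1 Y2 : finType).
Variables (PS : S1 * S2 -> R) (PY : S1 -> S2 -> X -> Y1 * Y2 -> R).
Hypotheses (hPS : is_pmf PS) (hPY : forall s1 s2 x, is_pmf (PY s1 s2 x)).
Variable c : @Defs.code R S1 Sh1 Sh2 X Y1 Y2.

Local Notation n := (blen c).
Local Notation P := (@block_law R S1 S2 Sh1 Sh2 X Y1 Y2 PS PY c).
Local Notation block_ := (@block R S1 S2 Sh1 Sh2 X Y1 Y2 c).
Local Notation bM_ := (@bM R S1 S2 Sh1 Sh2 X Y1 Y2 c).
Local Notation bS2_ := (@bS2 R S1 S2 Sh1 Sh2 X Y1 Y2 c).
Local Notation chan := (chan PS PY).
Local Notation M1 := (#|msg c|%:R^-1 : R).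

Let PY0 := PY_ge0 hPY.
Let chan0 := chan_ge0 hPS hPY.

Lemma M1_gt0 : 0 < M1.
Proof. by rewrite invr_gt0 ltr0n msg_gt0. Qed.

Definition input_law (m : msg c) (x : n.-tuple X) (y1 : n.-tuple Y1) (y2 : n.-tuple Y2) : R :=
  fine (rand_law c [set w | forall i, channel_input m y1 y2 w i = tnth x i]).

Lemma input_law_ge0 m x y1 y2 : 0 <= input_law m x y1 y2.
Proof. by apply: fine_ge0; exact: measure_ge0. Qed.

Lemma input_law_zip m x y1 y2 :
  input_law m x y1 y2 = input_prob (rand_law c) (fun i s w => enc i m s w) x (zipt y1 y2).
Proof. by []. Qed.

(** With [y1] frozen inside the encoder, the causal summation can run over [y2] alone. The
    reliability bound needs this, because its Fano kernel depends on [y1]. *)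
Lemma input_law_fix_y1 m x y1 y2 : input_law m x y1 y2 =
  input_prob (rand_law c) (fun i s w => enc i m (zip (take i y1) s) w) x y2.
Proof.
rewrite /input_law /input_prob /input_event /channel_input.
by under eq_set do under eq_forall do rewrite take_zip.
Qed.

Definition block_chan (x : n.-tuple X) (s1 : n.-tuple S1) (s2 : n.-tuple S2)
    (y1 : n.-tuple Y1) (y2 : n.-tuple Y2) : R :=
  \prod_i chan (tnth x i) (tnth s1 i) (tnth s2 i) (tnth y1 i) (tnth y2 i).

Lemma block_lawE m x s1 s2 y1 y2 :
  P (m, x, s1, s2, y1, y2) = M1 * input_law m x y1 y2 * block_chan x s1 s2 y1 y2.
Proof.
by rewrite /block_law /block_chan big_split /= -/(input_law m x y1 y2); ring.
Qed.

Lemma block_law_ge0 o : 0 <= P o.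
Proof.
case: o => [[[[[m x] s1] s2] y1] y2]; rewrite block_lawE.
by rewrite !mulr_ge0 ?input_law_ge0 ?prodr_ge0 // ltW ?M1_gt0.
Qed.

Lemma sum_block (F : block_ -> R) :
  \sum_o F o = \sum_m \sum_x \sum_s1 \sum_s2 \sum_y1 \sum_y2
    F (m, x, s1, s2, y1, y2 : n.-tuple Y2).
Proof.
by rewrite -[LHS]/(\sum_(p : msg c * n.-tuple X * n.-tuple S1 * n.-tuple S2 *
     n.-tuple Y1 * n.-tuple Y2) F p) !sum_pair.
Qed.

Lemma sum_input_law m (K : 'I_n -> X -> Y1 -> Y2 -> R) :
  (forall i x y1 y2, 0 <= K i x y1 y2) ->
  (forall i x, \sum_y1 \sum_y2 K i x y1 y2 = 1) ->
  \sum_x \sum_y1 \sum_y2 input_law m x y1 y2 *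
    \prod_i K i (tnth x i) (tnth y1 i) (tnth y2 i) = 1.
Proof.
move=> K0 K1.
rewrite -[RHS](@sum_input_kernel _ _ _ (rand_law c) _ _ _ (fun i s w => enc i m s w)
  _ (fun i x z => K i x z.1 z.2)) //.
- apply: eq_bigr => x _; rewrite sum_zipt; apply: eq_bigr => y1 _; apply: eq_bigr => y2 _.
  rewrite input_law_zip mulrC; congr (_ * _); apply: eq_bigr => i _.
  by rewrite tnth_zipt.
- by move=> i s x; exact: enc_measurable.
- by move=> i x; rewrite sum_pair.
Qed.

(** For fixed message and states, the inputs and outputs sum out causally to 1 in spite of the
    feedback. Hence the message is uniform and independent of the states. *)
Lemma sum_block_state (G : msg c -> n.-tuple S1 -> n.-tuple S2 -> R) :
  \sum_o P o * G (bM o) (bS1 o) (bS2 o) =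
  \sum_m \sum_s1 \sum_s2 M1 * (\prod_i PS (tnth s1 i, tnth s2 i)) * G m s1 s2.
Proof.
rewrite sum_block; apply: eq_bigr => m _.
rewrite exchange_big; apply: eq_bigr => s1 _; rewrite exchange_big; apply: eq_bigr => s2 _ /=.
rewrite -[RHS]mulr1 -[X in _ = _ * X]
  (@sum_input_law m (fun i x y1 y2 => PY (tnth s1 i) (tnth s2 i) x (y1, y2))) //;
  last by move=> i x; exact: sum_PY.
rewrite mulr_sumr; apply: eq_bigr => x _; rewrite mulr_sumr; apply: eq_bigr => y1 _.
rewrite mulr_sumr; apply: eq_bigr => y2 _.
by rewrite /= -/(input_law m x y1 y2); ring.
Qed.

Lemma sum_prod_PS : \sum_s1 \sum_s2 \prod_(i < n) PS (tnth s1 i, tnth s2 i) = 1.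
Proof.
have [_ PS1] := hPS.
have := @sum_tuple_prod R _ n (fun=> PS); under [RHS]eq_bigr do rewrite PS1.
rewrite big1_eq sum_zipt => E; rewrite -[RHS]E; apply: eq_bigr => s1 _; apply: eq_bigr => s2 _.
by apply: eq_bigr => i _; rewrite tnth_zipt.
Qed.

Lemma sum_M1 : \sum_(m : msg c) M1 = 1.
Proof.
by rewrite sumr_const -[LHS]mulr_natr mulVf // pnatr_eq0 -lt0n msg_gt0.
Qed.

Lemma sum_block_law : \sum_o P o = 1.
Proof.
have := sum_block_state (fun _ _ _ => 1); under eq_bigr do rewrite mulr1; move=> ->.
rewrite -[RHS]sum_M1; apply: eq_bigr => m _; rewrite -[RHS]mulr1 -[X in _ = _ * X]sum_prod_PS mulr_sumr.
apply: eq_bigr => s1 _; rewrite mulr_sumr; apply: eq_bigr => s2 _.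
by rewrite mulr1.
Qed.

Lemma law_msg_s2 m s2 : law P (pair_rv bM_ bS2_) (m, s2)
  = M1 * law P bS2_ s2.
Proof.
rewrite !law_sum.
rewrite (sum_block_state (fun m' _ s2' => ((m', s2') == (m, s2))%:R)).
rewrite (sum_block_state (fun _ _ s2' => (s2' == s2)%:R)).
rewrite (bigD1 m) //= [X in _ + X]big1 ?addr0 => [|m' m'm]; last first.
  apply: big1 => s1 _; apply: big1 => s2' _.
  by rewrite xpair_eqE (negPf m'm) mulr0.
rewrite sumr_const -[X in _ = _ * X]mulr_natl mulrA mulVf ?mul1r; last first.
  by rewrite pnatr_eq0 -lt0n msg_gt0.
by apply: eq_bigr => s1 _; apply: eq_bigr => s2' _; rewrite xpair_eqE eqxx.
Qed.

Lemma cond_entropy_msg_s2 :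
  cond_entropy P bM_ bS2_ = ln #|msg c|%:R.
Proof.
rewrite cond_entropyE -[RHS]mul1r -[X in _ = X * _]sum_block_law mulr_suml -sumrN.
apply: eq_bigr => o _; have [->|Po] := eqVneq (P o) 0; first by rewrite !mul0r oppr0.
have {}Po : 0 < P o by rewrite lt_neqAle eq_sym Po block_law_ge0.
rewrite /cond_law law_msg_s2 mulfK; last first.
  by rewrite gt_eqF // (law_gt0 block_law_ge0).
by rewrite lnV ?posrE ?ltr0n ?msg_gt0 // mulrN opprK.
Qed.

Definition letter_at (i : 'I_n) (o : block_) : letter :=
  (tnth (bX o) i, tnth (bS1 o) i, tnth (bS2 o) i, tnth (bY1 o) i, tnth (bY2 o) i).

Definition input_avg (x : X) : R :=
  n%:R^-1 * \sum_(i < n) law P (fun o : block_ => tnth (bX o) i) x.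

Lemma n1_gt0 : 0 < (n%:R^-1 : R).
Proof. by rewrite invr_gt0 ltr0n blen_gt0. Qed.

Lemma input_avg_pmf : is_pmf input_avg.
Proof.
split=> [x|].
  rewrite /input_avg mulr_ge0 ?(ltW n1_gt0) ?sumr_ge0 // => i _; exact: (law_ge0 block_law_ge0).
rewrite -mulr_sumr exchange_big /=.
under eq_bigr do rewrite sum_law1 // sum_block_law.
by rewrite sumr_const card_ord -[1 *+ n]/(n%:R) mulVf // pnatr_eq0 -lt0n blen_gt0.
Qed.

(* The triple (states, outputs) of a letter is generated from its input by
   [chan], so the block law is a causal product over that larger alphabet. *)
Lemma sum_block_causal (h : letter -> R) (i0 : 'I_n) : (forall l, 0 <= h l) ->
  \sum_o P o * h (letter_at i0 o) =
  \sum_o P o * \sum_s1 \sum_s2 \sum_y1 \sum_y2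
     chan (tnth (bX o) i0) s1 s2 y1 y2 * h (tnth (bX o) i0, s1, s2, y1, y2).
Proof.
move=> h0; rewrite !sum_block; apply: eq_bigr => m _.
pose Z : finType := ((S1 * S2) * (Y1 * Y2))%type.
(* The history of enlarged letters contains the states, and [map snd] hides them from the
   encoder. *)
pose f (i : 'I_n) (s : seq Z) w := enc i m (map snd s) w.
pose K (i : 'I_n) (x : X) (z : Z) := chan x z.1.1 z.1.2 z.2.1 z.2.2.
pose h' x (z : Z) := h (x, z.1.1, z.1.2, z.2.1, z.2.2).
have mf i s x : measurable [set w | f i s w = x] by exact: enc_measurable.
have K0 i x z : 0 <= K i x z by exact: chan0.
have h'0 x z : 0 <= h' x z by exact: h0.
have K1 i x : \sum_z K i x z = 1.
  rewrite !sum_pair -(sum_PS hPS); apply: eq_bigr => s1 _; apply: eq_bigr => s2 _.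
  by rewrite sum_pair; exact: sum_chan_y.
have E (G : n.-tuple X -> n.-tuple S1 -> n.-tuple S2 -> n.-tuple Y1 -> n.-tuple Y2 -> R) :
    \sum_x \sum_s1 \sum_s2 \sum_y1 \sum_y2
      P (m, x, s1, s2, y1, y2) * G x s1 s2 y1 y2 =
    M1 * \sum_x \sum_(z : n.-tuple Z) (\prod_i K i (tnth x i) (tnth z i)) *
      G x (map_tuple (fst \o fst) z) (map_tuple (snd \o fst) z)
        (map_tuple (fst \o snd) z) (map_tuple (snd \o snd) z) *
      input_prob (rand_law c) f x z.
  rewrite mulr_sumr; apply: eq_bigr => x _.
  rewrite sum_zipt sum_zipt mulr_sumr; apply: eq_bigr => s1 _.
  rewrite mulr_sumr; apply: eq_bigr => s2 _.
  rewrite sum_zipt mulr_sumr; apply: eq_bigr => y1 _.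
  rewrite mulr_sumr; apply: eq_bigr => y2 _.
  set z := zipt _ _.
  have z1 : map_tuple (fst \o fst) z = s1.
    by apply: eq_from_tnth => i; rewrite tnth_map /= !tnth_zipt.
  have z2 : map_tuple (snd \o fst) z = s2.
    by apply: eq_from_tnth => i; rewrite tnth_map /= !tnth_zipt.
  have z3 : map_tuple (fst \o snd) z = y1.
    by apply: eq_from_tnth => i; rewrite tnth_map /= !tnth_zipt.
  have z4 : map_tuple (snd \o snd) z = y2.
    by apply: eq_from_tnth => i; rewrite tnth_map /= !tnth_zipt.
  rewrite z1 z2 z3 z4 block_lawE.
  have -> : input_law m x y1 y2 = input_prob (rand_law c) f x z.
    rewrite input_law_zip /input_prob /input_event /f.
    have zz : map snd z = zipt y1 y2.
      rewrite -[RHS]/(val (zipt y1 y2)) -[LHS]/(val (map_tuple snd z)); congr val.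
      by apply: eq_from_tnth => i; rewrite tnth_map !tnth_zipt.
    by under eq_set do under eq_forall do rewrite -zz -map_take.
  have -> : block_chan x s1 s2 y1 y2 = \prod_i K i (tnth x i) (tnth z i).
    by apply: eq_bigr => i _; rewrite /K !tnth_zipt.
  by ring.
rewrite (E (fun x s1 s2 y1 y2 => h (tnth x i0, tnth s1 i0, tnth s2 i0, tnth y1 i0, tnth y2 i0))).
rewrite (E (fun x _ _ _ _ => \sum_s1 \sum_s2 \sum_y1 \sum_y2
     chan (tnth x i0) s1 s2 y1 y2 * h (tnth x i0, s1, s2, y1, y2))).
congr (M1 * _).
transitivity (\sum_x \sum_(z : n.-tuple Z) (\prod_i K i (tnth x i) (tnth z i)) *
    h' (tnth x i0) (tnth z i0) * input_prob (rand_law c) f x z).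
  by apply: eq_bigr => x _; apply: eq_bigr => z _; rewrite !tnth_map.
rewrite (sum_input_letter _ mf K0 i0 h'0 K1).
apply: eq_bigr => x _; apply: eq_bigr => z _; congr (_ * _ * _).
rewrite sum_pair sum_pair; apply: eq_bigr => s1 _; apply: eq_bigr => s2 _.
by rewrite sum_pair.
Qed.

(** Causal averaging applied to an indicator: an input depends on earlier outputs only, so its own
    states and outputs still follow [chan] given that input. *)
Lemma law_letter_at i x s1 s2 y1 y2 :
  law P (letter_at i) (x, s1, s2, y1, y2) =
  law P (fun o : block_ => tnth (bX o) i) x * chan x s1 s2 y1 y2.
Proof.
rewrite [in LHS]law_sum (@sum_block_causal (fun l => (l == (x, s1, s2, y1, y2))%:R)); last first.
  by move=> l; exact: ler0n.
rewrite law_sum mulr_suml; apply: eq_bigr => o _; rewrite -mulrA; congr (_ * _).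
have [->|xn] := eqVneq (tnth (bX o) i) x; last first.
  rewrite mul0r big1 // => s1' _; rewrite big1 // => s2' _.
  rewrite big1 // => y1' _; rewrite big1 // => y2' _.
  by rewrite !xpair_eqE (negPf xn) mulr0.
rewrite mul1r (bigD1 s1) //= [X in _ + X]big1 ?addr0 => [|s1' ne]; last first.
  rewrite big1 // => s2' _; rewrite big1 // => y1' _; rewrite big1 // => y2' _.
  by rewrite !xpair_eqE (negPf ne) andbF mulr0.
rewrite (bigD1 s2) //= [X in _ + X]big1 ?addr0 => [|s2' ne]; last first.
  rewrite big1 // => y1' _; rewrite big1 // => y2' _.
  by rewrite !xpair_eqE (negPf ne) andbF mulr0.
rewrite (bigD1 y1) //= [X in _ + X]big1 ?addr0 => [|y1' ne]; last first.
  by rewrite big1 // => y2' _; rewrite !xpair_eqE (negPf ne) andbF mulr0.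
rewrite (bigD1 y2) //= [X in _ + X]big1 ?addr0 => [|y2' ne]; last first.
  by rewrite !xpair_eqE (negPf ne) andbF mulr0.
by rewrite eqxx mulr1.
Qed.

Local Notation L := (letter_law PS PY input_avg : letter -> R).

Lemma sum_letters (g : letter -> R) :
  \sum_o P o * \sum_(i < n) g (letter_at i o) = n%:R * \sum_l L l * g l.
Proof.
under eq_bigr do rewrite mulr_sumr.
rewrite exchange_big /=; under eq_bigr do rewrite -sum_law.
rewrite exchange_big /= mulr_sumr; apply: eq_bigr => -[[[[x s1] s2] y1] y2] _.
under eq_bigr do rewrite law_letter_at.
rewrite -mulr_suml -mulr_suml letter_lawE /input_avg.
by rewrite !mulrA divff ?mul1r // pnatr_eq0 -lt0n blen_gt0.
Qed.

(** The average law dominates 1/n times the law of the [i]-th letter, so densities with respect to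
    [L] are safe on the support of the block law. *)
Lemma letter_at_gt0 i o : 0 < P o -> 0 < L (letter_at i o).
Proof.
move=> Po; have := law_gt0 block_law_ge0 (letter_at i) Po.
rewrite /letter_at law_letter_at => l0.
rewrite letter_lawE /input_avg -mulrA mulr_gt0 ?n1_gt0 // mulr_suml.
rewrite (bigD1 i) //= ltr_wpDr // sumr_ge0 // => j _.
by rewrite mulr_ge0 ?chan0 // law_ge0 // => ?; exact: block_law_ge0.
Qed.

End BlockLaw.

(** * Single-letter bounds *)

Lemma ln_prod (R : realType) (I : finType) (f : I -> R) :
  (forall i, 0 < f i) -> ln (\prod_i f i) = \sum_i ln (f i).
Proof.
move=> f0; suff [] : 0 < \prod_i f i /\ ln (\prod_i f i) = \sum_i ln (f i) by [].
elim/big_rec2: _ => [|i x y _ [y0 E]]; first by rewrite ln1.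
by rewrite mulr_gt0 // lnM ?posrE // E.
Qed.

Section Converse.
Variables (R : realType) (S1 S2 Sh1 Sh2 X Y1 Y2 : finType).
Variables (PS : S1 * S2 -> R) (PY : S1 -> S2 -> X -> Y1 * Y2 -> R).
Hypotheses (hPS : is_pmf PS) (hPY : forall s1 s2 x, is_pmf (PY s1 s2 x)).
Variable c : @Defs.code R S1 Sh1 Sh2 X Y1 Y2.

Local Notation n := (blen c).
Local Notation P := (@block_law R S1 S2 Sh1 Sh2 X Y1 Y2 PS PY c).
Local Notation block_ := (@block R S1 S2 Sh1 Sh2 X Y1 Y2 c).
Local Notation bM_ := (@bM R S1 S2 Sh1 Sh2 X Y1 Y2 c).
Local Notation bS2_ := (@bS2 R S1 S2 Sh1 Sh2 X Y1 Y2 c).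
Local Notation bY1_ := (@bY1 R S1 S2 Sh1 Sh2 X Y1 Y2 c).
Local Notation bY2_ := (@bY2 R S1 S2 Sh1 Sh2 X Y1 Y2 c).
Local Notation chan := (chan PS PY).
Local Notation chan_s1y1 := (chan_s1y1 PS PY).
Local Notation chan_y1y2s2 := (chan_y1y2s2 PS PY).
Local Notation M1 := (#|msg c|%:R^-1 : R).
Local Notation PX := (input_avg PS PY c).
Local Notation letter_ := (@letter S1 S2 X Y1 Y2).
Local Notation L := (letter_law PS PY PX : letter_ -> R).

Let P0 : forall o : block_, 0 <= P o := block_law_ge0 hPS hPY (c := c).
Let PX1 : is_pmf PX := input_avg_pmf hPS hPY c.
Let L0 : forall l, 0 <= L l := letter_law_ge0 hPS hPY PX1.
Let chan0 := chan_ge0 hPS hPY.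

Definition fano (e : R) (m : msg c) (y1 : n.-tuple Y1) (s1 : n.-tuple S1) : R :=
  (1 - e) * (m == dec y1 s1)%:R + e * M1.

Section RateBounds.
Variable e : R.
Hypotheses (e0 : 0 < e) (e1 : e < 1).

Lemma sum_fano y1 s1 : \sum_m fano e m y1 s1 = 1.
Proof.
rewrite /fano big_split /= -!mulr_sumr (sum_M1 c) mulr1.
rewrite (bigD1 (dec y1 s1)) //= eqxx big1 ?addr0 ?mulr1 ?subrK // => m.
by move=> /negPf ->.
Qed.

Lemma fano_gt0 m y1 s1 : 0 < fano e m y1 s1.
Proof.
rewrite /fano ltr_wpDl ?mulr_gt0 ?(M1_gt0 c) // mulr_ge0 ?ler0n //.
by rewrite subr_ge0 ltW.
Qed.

(** Fano's inequality in pointwise form. A correct decoding costs at most - ln (1 - e), and an error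
    costs ln |M| - ln e, which is at most the sum of both. The error cost is nonnegative, so
    [error_prob] may be replaced by [e]. *)
Lemma expect_ln_fano : error_prob PS PY c <= e ->
  - \sum_(o : block_) P o * ln (fano e (bM o) (bY1 o) (bS1 o))
    <= - ln (1 - e) + e * (ln #|msg c|%:R - ln e).
Proof.
move=> Pe.
have le0 : 0 <= ln #|msg c|%:R - ln e :> R.
  rewrite subr_ge0 (@le_trans _ _ 0) ?ln_le0 ?(ltW e1) //.
  by rewrite ln_ge0 // ler1n msg_gt0.
have l1e : ln (1 - e) <= 0 by rewrite ln_le0 // gerBl ltW.
apply: (@le_trans _ _ (\sum_(o : block_) P o *
   (- ln (1 - e) + (bM o != dec (bY1 o) (bS1 o))%:R * (ln #|msg c|%:R - ln e)))).
  rewrite -sumrN; apply: ler_sum => o _; rewrite -mulrN ler_wpM2l ?P0 //.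
  rewrite /fano; case: eqP => _ /=.
    rewrite mul0r addr0 lerN2 mulr1 ler_ln ?posrE ?subr_gt0 //.
      by rewrite lerDl mulr_ge0 ?ltW ?M1_gt0.
    by rewrite ltr_pwDl ?subr_gt0 // mulr_ge0 ?ltW ?M1_gt0.
  rewrite mulr0 add0r mul1r lnM ?posrE ?M1_gt0 // lnV ?posrE ?ltr0n ?msg_gt0 //.
  by rewrite opprD opprK addrC lerDr oppr_ge0.
under eq_bigr do rewrite mulrDr mulrA.
rewrite big_split /= -!mulr_suml (sum_block_law hPS hPY) mul1r lerD2l ler_wpM2r //.
apply: le_trans Pe; rewrite /error_prob /prob [leRHS]big_mkcond /=.
by apply: ler_sum => o _; case: ifP => h; rewrite (mulr1, mulr0).
Qed.

(** The form common to both rate bounds: a block density times a product of single-letter densities,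
    whose logarithms add up to [n] expectations under [L]. *)
Lemma expect_ln_letters (a : block_ -> R) (g : letter_ -> R) :
  (forall o, 0 < P o -> 0 < a o) -> (forall l, 0 < L l -> 0 < g l) ->
  \sum_(o : block_) P o * (a o * \prod_(i < n) g (letter_at i o)) <= 1 ->
  \sum_(o : block_) P o * ln (a o) + n%:R * (\sum_l L l * ln (g l)) <= 0.
Proof.
move=> a0 g0 EZ.
have gp o i : 0 < P o -> 0 < g (letter_at i o).
  by move=> Po; apply: g0; exact: letter_at_gt0.
have := @expect_ln_le0 _ _ _ P0 (fun o => a o * \prod_(i < n) g (letter_at i o))
  (sum_block_law hPS hPY c) _ EZ.
rewrite -(sum_letters hPS hPY c (fun l => ln (g l))) -big_split /= => H.
apply: le_trans (H _); last by move=> o Po; rewrite mulr_gt0 ?a0 // prodr_gt0 // => i _; exact: gp.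
rewrite le_eqVlt; apply/orP; left; apply/eqP; apply: eq_bigr => o _.
have [->|Po] := eqVneq (P o) 0; first by rewrite !mul0r addr0.
have {}Po : 0 < P o by rewrite lt_neqAle eq_sym Po P0.
have gs : 0 < \prod_(i < n) g (letter_at i o) by apply: prodr_gt0 => i _; exact: gp.
by rewrite lnM ?posrE ?a0 // ln_prod ?mulrDr // => i; exact: gp.
Qed.

Definition rate_leak : R :=
  cond_entropy L (pair_rv lY1 lS1) (pair_rv lY2 lS2)
  - cond_entropy L lS1 (pair_rv (pair_rv lY1 lY2) (pair_rv lS2 lX)).

(** This is the order of elimination in the reliability bound: [s2] innermost, then [y2] and the
    inputs, with [s1] and [y1] left for last. *)
Lemma bigsum5_rot (A B C D E : finType) (F : A -> B -> C -> D -> E -> R) :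
  \sum_a \sum_b \sum_c \sum_d \sum_e F a b c d e
  = \sum_b \sum_d \sum_a \sum_e \sum_c F a b c d e.
Proof.
rewrite exchange_big; apply: eq_bigr => b _.
under eq_bigr do rewrite exchange_big.
rewrite exchange_big; apply: eq_bigr => d _; apply: eq_bigr => a _.
by rewrite exchange_big.
Qed.

(** A change of measure. Weighting [P] by the density gives (Y1, S1) the product of its
    single-letter laws under [L], gives the message the Fano kernel, and leaves a causal kernel for
    the inputs, S2 and Y2. The total mass is therefore at most 1. *)
Lemma ln_msg_le_mutual_info :
  ln #|msg c|%:R <= n%:R * cond_mutual_info L lX lY1 lS1
    - \sum_(o : block_) P o * ln (fano e (bM o) (bY1 o) (bS1 o)).
Proof.
pose q (l : letter_) := law L (pair_rv lY1 lS1) (lY1 l, lS1 l).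
pose C (l : letter_) := chan_s1y1 (lX l) (lS1 l) (lY1 l).
have C0 l : 0 < L l -> 0 < C l.
  case: l => [[[[x s1] s2] y1] y2]; rewrite letter_lawE /C /= => Ll.
  have ch : 0 < chan x s1 s2 y1 y2.
    rewrite lt_neqAle chan0 andbT eq_sym; apply: contraTneq Ll => ->.
    by rewrite mulr0 ltxx.
  exact: lt_le_trans ch (chan_le_s1y1 hPS hPY _ _ _ _ _).
have g0 l : 0 < L l -> 0 < q l / C l.
  by move=> Ll; rewrite divr_gt0 ?C0 // (law_gt0 L0 (pair_rv lY1 lS1)).
have -> : n%:R * cond_mutual_info L lX lY1 lS1 = n%:R * \sum_l L l * - ln (q l / C l).
  congr (_ * _); rewrite /cond_mutual_info !cond_entropyE opprK addrC -sumrB.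
  apply: eq_bigr => l _; have [->|Ll] := eqVneq (L l) 0; first by rewrite !mul0r subrr.
  have {}Ll : 0 < L l by rewrite lt_neqAle eq_sym Ll L0.
  rewrite -mulrBr; congr (_ * _).
  (* Cancelling the input law turns the ratio of posteriors of X into L(y1, s1) / P(s1, y1 | x),
     whose denominator is a marginal of [chan]. *)
  have : q l / C l = cond_law L lX lS1 (lX l) (lS1 l)
      / cond_law L lX (pair_rv lY1 lS1) (lX l) (lY1 l, lS1 l).
    by move: l Ll => [[[[x s1] s2] y1] y2] Ll; rewrite (cond_law_x_ratio hPS hPY PX1 Ll).
  move=> ->; rewrite ln_div ?posrE; [|exact: (cond_law_gt0 L0)|].
    by rewrite opprB.
  exact: (cond_law_gt0 L0 lX (pair_rv lY1 lS1)).
have a0 (o : block_) : 0 < P o -> 0 < #|msg c|%:R * fano e (bM o) (bY1 o) (bS1 o).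
  by move=> _; rewrite mulr_gt0 ?fano_gt0 // ltr0n msg_gt0.
have := @expect_ln_letters _ _ a0 g0 _.
have -> : \sum_(o : block_) P o * ln (#|msg c|%:R * fano e (bM o) (bY1 o) (bS1 o)) =
   ln #|msg c|%:R + \sum_(o : block_) P o * ln (fano e (bM o) (bY1 o) (bS1 o)).
  rewrite -[X in X + _]mul1r -[X in X * _ + _](sum_block_law hPS hPY c) mulr_suml -big_split /=.
  apply: eq_bigr => o _; rewrite lnM ?posrE ?fano_gt0 ?ltr0n ?msg_gt0 //.
  by rewrite mulrDr.
move=> H; under eq_bigr do rewrite mulrN.
rewrite sumrN mulrN -subr_le0 opprB opprK.
set t := ln _ in H *; set u := \sum_(o : block_) _ in H *; set v := _ * _ in H *.
suff /H : \sum_(o : block_) P o * (#|msg c|%:R * fano e (bM o) (bY1 o) (bS1 o) *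
   \prod_(i < n) (q (letter_at i o) / C (letter_at i o))) <= 1 by lra.
rewrite sum_block.
pose qq (s1 : n.-tuple S1) (y1 : n.-tuple Y1) := \prod_i law L (pair_rv lY1 lS1) (tnth y1 i, tnth s1 i).
(* The kernel P(s2, y2 | x, s1, y1). Division by 0 yields 0, so its mass is 1 or 0 and only an upper
   bound is available. *)
pose V (s1 : n.-tuple S1) (y1 : n.-tuple Y1) i x (s2 : S2) y2 :=
  chan x (tnth s1 i) s2 (tnth y1 i) y2 / chan_s1y1 x (tnth s1 i) (tnth y1 i).
have E m x s1 s2 y1 y2 : P (m, x, s1, s2, y1, y2) * (#|msg c|%:R * fano e m y1 s1 *
   \prod_(i < n) (q (letter_at i (m, x, s1, s2, y1, y2)) / C (letter_at i (m, x, s1, s2, y1, y2))))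
   = fano e m y1 s1 * qq s1 y1 *
     (input_law m x y1 y2 * \prod_i V s1 y1 i (tnth x i) (tnth s2 i) (tnth y2 i)).
  have -> : \prod_i V s1 y1 i (tnth x i) (tnth s2 i) (tnth y2 i) =
      block_chan PS PY x s1 s2 y1 y2 *
      \prod_i (chan_s1y1 (tnth x i) (tnth s1 i) (tnth y1 i))^-1 by rewrite -big_split.
  rewrite big_split -/(qq s1 y1) block_lawE -[X in _ * (_ * X)]/(_ * _).
  set A := \prod_(i < n) (chan_s1y1 _ _ _)^-1; set B := block_chan _ _ _ _ _ _ _.
  by field; rewrite pnatr_eq0 -lt0n msg_gt0.
under eq_bigr => m _.
  rewrite bigsum5_rot /=.
  under eq_bigr => s1 _.
    under eq_bigr => y1 _.
      under eq_bigr => x _.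
        under eq_bigr => y2 _.
          under eq_bigr do rewrite /= E.
          rewrite -mulr_sumr -mulr_sumr.
          rewrite (sum_tuple_prod (fun i s2 => V s1 y1 i (tnth x i) s2 (tnth y2 i))); over.
        rewrite -mulr_sumr; over.
      rewrite -mulr_sumr; over.
    over.
  over.
have qq0 s1 y1 : 0 <= qq s1 y1 by apply: prodr_ge0 => i _; exact: law_ge0.
apply: (@le_trans _ _ (\sum_m \sum_s1 \sum_y1 fano e m y1 s1 * qq s1 y1)).
  apply: ler_sum => m _; apply: ler_sum => s1 _; apply: ler_sum => y1 _.
  rewrite -[leRHS]mulr1 ler_wpM2l ?mulr_ge0 ?qq0 ?(ltW (fano_gt0 _ _ _)) //.
  have V0 i x y2 : 0 <= \sum_s2 V s1 y1 i x s2 y2.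
    by apply: sumr_ge0 => s2 _; rewrite divr_ge0 ?chan0 ?chan_s1y1_ge0.
  apply: le_trans (@sum_input_kernel_le _ _ _ (rand_law c) _ _ _
    (fun i s w => enc i m (zip (take i y1) s) w) _ _ V0 _).
  - rewrite le_eqVlt; apply/orP; left; apply/eqP; apply: eq_bigr => x _; apply: eq_bigr => y2 _.
    by rewrite input_law_fix_y1 mulrC.
  - by move=> *; exact: enc_measurable.
  - move=> i x; rewrite exchange_big; under eq_bigr do rewrite -mulr_suml.
    rewrite -mulr_suml -/(chan_s1y1 _ _ _).
    have [->|/divff->//] := eqVneq (chan_s1y1 x (tnth s1 i) (tnth y1 i)) 0.
    by rewrite mul0r.
(* The message is summed out first, through the Fano kernel. What remains is a product law on (y1,
   s1). *)
rewrite exchange_big /=; under eq_bigr do rewrite exchange_big /=.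
under eq_bigr do under eq_bigr do rewrite -mulr_suml sum_fano mul1r.
have -> : \sum_(s1 : n.-tuple S1) \sum_(y1 : n.-tuple Y1) qq s1 y1 = 1; last by [].
rewrite exchange_big /=.
have := @sum_tuple_prod R _ n (fun=> law L (pair_rv lY1 lS1)).
under [RHS]eq_bigr do rewrite sum_law1 (sum_letter_law hPS hPY PX1).
rewrite big1_eq sum_zipt => F; rewrite -[RHS]F; apply: eq_bigr => y1 _; apply: eq_bigr => s1 _.
by apply: eq_bigr => i _; rewrite tnth_zipt.
Qed.
(** The leakage enters through H(M | Y2^n, S2^n) = ln |M| - I(M; Y2^n | S2^n). In the weighted block
    law, summing over [x] leaves P(m, y1, y2, s2), which is bounded by P(m, y2, s2). Dividing by P(m
    | y2, s2) leaves the law of (Y2^n, S2^n). The Fano kernel then absorbs the sum over [m], and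
    L(y1, s1 | y2, s2) absorbs the sum over (y1, s1). *)
Lemma ln_msg_le_rate_leak :
  ln #|msg c|%:R <= leakage PS PY c + n%:R * rate_leak
    - \sum_(o : block_) P o * ln (fano e (bM o) (bY1 o) (bS1 o)).
Proof.
pose W := pair_rv bY2_ bS2_.
pose pM (o : block_) := cond_law P bM_ W (bM o) (W o).
pose q (l : letter_) := cond_law L (pair_rv lY1 lS1) (pair_rv lY2 lS2) (lY1 l, lS1 l) (lY2 l, lS2 l).
pose C (l : letter_) := chan (lX l) (lS1 l) (lS2 l) (lY1 l) (lY2 l).
pose B (l : letter_) := chan_y1y2s2 (lX l) (lY1 l) (lY2 l) (lS2 l).
have C0 l : 0 < L l -> 0 < C l.
  case: l => [[[[x s1] s2] y1] y2]; rewrite letter_lawE /C /= => Ll.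
  rewrite lt_neqAle chan0 andbT eq_sym; apply: contraTneq Ll => ->.
  by rewrite mulr0 ltxx.
have B0 l : 0 < L l -> 0 < B l.
  by move=> /C0 h; apply: lt_le_trans h (chan_le_y1y2s2 hPS hPY _ _ _ _ _).
have q0 l : 0 < L l -> 0 < q l.
  exact: (cond_law_gt0 L0 (pair_rv lY1 lS1) (pair_rv lY2 lS2)).
have g0 l : 0 < L l -> 0 < q l * (B l / C l).
  by move=> Ll; apply: mulr_gt0; [exact: q0 | exact: divr_gt0 (B0 _ Ll) (C0 _ Ll)].
have -> : n%:R * rate_leak = n%:R * \sum_l L l * - ln (q l * (B l / C l)).
  congr (_ * _); rewrite /rate_leak !cond_entropyE opprK addrC -sumrB.
  apply: eq_bigr => l _; have [->|Ll] := eqVneq (L l) 0; first by rewrite !mul0r subrr.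
  have {}Ll : 0 < L l by rewrite lt_neqAle eq_sym Ll L0.
  rewrite -mulrBr; congr (_ * _); have BC : 0 < B l / C l by exact: divr_gt0 (B0 _ Ll) (C0 _ Ll).
  rewrite (lnM (q0 _ Ll) BC) opprD -(lnV BC) invf_div addrC; congr (_ + _).
  congr ln; move: l Ll {BC} => [[[[x s1] s2] y1] y2] Ll.
  exact: (cond_law_s1 Ll).
have pM0 (o : block_) : 0 < P o -> 0 < pM o by exact: (cond_law_gt0 P0 bM_ W).
have a0 (o : block_) : 0 < P o -> 0 < fano e (bM o) (bY1 o) (bS1 o) / pM o.
  by move=> Po; rewrite divr_gt0 ?fano_gt0 ?pM0.
have := @expect_ln_letters _ _ a0 g0 _.
have -> : \sum_(o : block_) P o * ln (fano e (bM o) (bY1 o) (bS1 o) / pM o) =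
   \sum_(o : block_) P o * ln (fano e (bM o) (bY1 o) (bS1 o))
   + (ln #|msg c|%:R - leakage PS PY c).
  have -> : ln #|msg c|%:R - leakage PS PY c = cond_entropy P bM_ W.
    by rewrite /leakage /cond_mutual_info (cond_entropy_msg_s2 hPS hPY) opprB addrC subrK.
  rewrite cond_entropyE -sumrB; apply: eq_bigr => o _.
  have [->|Po] := eqVneq (P o) 0; first by rewrite !mul0r subrr.
  have {}Po : 0 < P o by rewrite lt_neqAle eq_sym Po P0.
  by rewrite -mulrBr ln_div ?posrE ?fano_gt0 ?pM0.
move=> H; under [X in n%:R * X]eq_bigr do rewrite mulrN.
rewrite sumrN mulrN.
set t := ln _ in H *; set u := \sum_(o : block_) _ in H *; set v := _ * (\sum_l _) in H *.
suff /H : \sum_(o : block_) P o * (fano e (bM o) (bY1 o) (bS1 o) / pM o *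
   \prod_(i < n) (q (letter_at i o) * (B (letter_at i o) / C (letter_at i o)))) <= 1 by lra.
rewrite sum_block.
pose qq (s1 : n.-tuple S1) (s2 : n.-tuple S2) (y1 : n.-tuple Y1) (y2 : n.-tuple Y2) :=
  \prod_i cond_law L (pair_rv lY1 lS1) (pair_rv lY2 lS2)
     (tnth y1 i, tnth s1 i) (tnth y2 i, tnth s2 i).
pose BB (x : n.-tuple X) (s2 : n.-tuple S2) (y1 : n.-tuple Y1) (y2 : n.-tuple Y2) :=
  \prod_i chan_y1y2s2 (tnth x i) (tnth y1 i) (tnth y2 i) (tnth s2 i).
pose pw m (y2 : n.-tuple Y2) (s2 : n.-tuple S2) := cond_law P bM_ W m (y2, s2).
have qq0 s1 s2 y1 y2 : 0 <= qq s1 s2 y1 y2.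
  by apply: prodr_ge0 => i _; exact: cond_law_ge0.
have F0 m y1 s1 : 0 <= fano e m y1 s1 by exact/ltW/fano_gt0.
have pw0 m y2 s2 : 0 <= pw m y2 s2 by exact: cond_law_ge0.
(* Only an inequality holds: where [chan] vanishes, its product with [B / C] is 0 instead of [B]. *)
have E m x s1 s2 y1 y2 : P (m, x, s1, s2, y1, y2) * (fano e m y1 s1 / pM (m, x, s1, s2, y1, y2) *
   \prod_(i < n) (q (letter_at i (m, x, s1, s2, y1, y2)) *
     (B (letter_at i (m, x, s1, s2, y1, y2)) / C (letter_at i (m, x, s1, s2, y1, y2)))))
   <= fano e m y1 s1 * qq s1 s2 y1 y2 / pw m y2 s2 * (M1 * input_law m x y1 y2 * BB x s2 y1 y2).
  rewrite big_split -/(qq s1 s2 y1 y2) -[X in _ * (_ * X)]/(_ * _) block_lawE -/(pw m y2 s2).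
  set D := \prod_(i < n) _.
  have : block_chan PS PY x s1 s2 y1 y2 * D <= BB x s2 y1 y2.
    rewrite -big_split /=; apply: ler_prod => i _; rewrite /C /B /=.
    have := chan_y1y2s2_ge0 hPS hPY (tnth x i) (tnth y1 i) (tnth y2 i) (tnth s2 i).
    have := chan0 (tnth x i) (tnth s1 i) (tnth s2 i) (tnth y1 i) (tnth y2 i).
    set k := chan _ _ _ _ _; set b := chan_y1y2s2 _ _ _ _ => k0 b0.
    rewrite mulr_ge0 ?divr_ge0 //=.
    have [->|kn] := eqVneq k 0; first by rewrite mul0r.
    by rewrite mulrCA divff ?mulr1.
  move=> DB.
  have -> : M1 * input_law m x y1 y2 * block_chan PS PY x s1 s2 y1 y2 *
      (fano e m y1 s1 / pw m y2 s2 * (qq s1 s2 y1 y2 * D)) =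
    fano e m y1 s1 * qq s1 s2 y1 y2 / pw m y2 s2 *
    (M1 * input_law m x y1 y2 * (block_chan PS PY x s1 s2 y1 y2 * D)) by ring.
  rewrite ler_wpM2l ?ler_wpM2l //.
    by apply: divr_ge0 (pw0 _ _ _); exact: mulr_ge0.
  by rewrite mulr_ge0 ?input_law_ge0 // ltW ?M1_gt0.
pose pm m (y2 : n.-tuple Y2) (s2 : n.-tuple S2) := law P (pair_rv bM_ W) (m, (y2, s2)).
(* The left side is the joint law of the message, Y1^n, Y2^n and S2^n. Dropping Y1^n can only
   increase it. *)
have sum_x m s2 y1 y2 : \sum_x M1 * input_law m x y1 y2 * BB x s2 y1 y2 <= pm m y2 s2.
  apply: le_trans (law_pair_ler P0 bY1_ (pair_rv bM_ W) y1 (m, (y2, s2))).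
  rewrite /law /prob (reindex (fun p : n.-tuple X * n.-tuple S1 => (m, p.1, p.2, s2, y1, y2))) /=; last first.
    exists (fun o : block_ => (bX o, bS1 o)) => [[x s1] //|[[[[[m' x] s1] s2'] y1'] y2']].
    by rewrite inE => /eqP[-> -> -> ->].
  rewrite le_eqVlt; apply/orP; left; apply/eqP; under [RHS]eq_bigl do rewrite eqxx.
  rewrite sum_pair; apply: eq_bigr => x _ /=.
  under [RHS]eq_bigr do rewrite -/(block_law PS PY (m, x, _, s2, y1, y2)) block_lawE.
  rewrite -mulr_sumr; congr (_ * _).
  by rewrite (sum_tuple_prod (fun i s1 => chan (tnth x i) s1 (tnth s2 i) (tnth y1 i) (tnth y2 i))).
apply: (@le_trans _ _ (\sum_m \sum_s1 \sum_s2 \sum_y1 \sum_y2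
   fano e m y1 s1 * qq s1 s2 y1 y2 * law P W (y2, s2))).
  apply: ler_sum => m _; rewrite exchange_big; apply: ler_sum => s1 _.
  rewrite exchange_big; apply: ler_sum => s2 _; rewrite exchange_big; apply: ler_sum => y1 _.
  rewrite exchange_big; apply: ler_sum => y2 _.
  apply: le_trans (ler_sum _ (fun x _ => E m x s1 s2 y1 y2)) _; rewrite -mulr_sumr.
  have fq : 0 <= fano e m y1 s1 * qq s1 s2 y1 y2 by exact: mulr_ge0.
  apply: le_trans (ler_wpM2l _ (sum_x _ _ _ _)) _; first exact: divr_ge0 fq (pw0 _ _ _).
  rewrite -[leLHS]mulrA; apply: ler_wpM2l => //; rewrite /pw /cond_law -/(pm m y2 s2).
  have [->|pn] := eqVneq (pm m y2 s2) 0; first by rewrite mulr0 law_ge0.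
  by rewrite invf_div -mulrA mulVf ?mulr1.
rewrite exchange_big /=; under eq_bigr do rewrite exchange_big /=.
under eq_bigr do under eq_bigr do rewrite exchange_big /=.
under eq_bigr do under eq_bigr do under eq_bigr do rewrite exchange_big /=.
under eq_bigr do under eq_bigr do under eq_bigr do under eq_bigr do
  rewrite -mulr_suml -mulr_suml sum_fano mul1r.
(* The sums over [s2] and [y2] move outermost, so that the conditional law [qq] can be summed over
   [y1] and [s1]. *)
rewrite exchange_big /=; under eq_bigr do under eq_bigr do rewrite exchange_big /=.
under eq_bigr do rewrite exchange_big /=.
under eq_bigr do under eq_bigr do rewrite exchange_big /=.
under eq_bigr do under eq_bigr do under eq_bigr do rewrite -mulr_suml.
under eq_bigr do under eq_bigr do rewrite -mulr_suml.
have -> : 1 = \sum_(s2 : n.-tuple S2) \sum_(y2 : n.-tuple Y2) law P W (y2, s2).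
  by rewrite exchange_big /= -(sum_pair (law P W)) (sum_law1 P W) (sum_block_law hPS hPY).
apply: ler_sum => s2 _; apply: ler_sum => y2 _.
rewrite -[leRHS]mul1r ler_wpM2r ?law_ge0 //.
apply: (@le_trans _ _ (\prod_(i < n) \sum_a cond_law L (pair_rv lY1 lS1) (pair_rv lY2 lS2)
     a (tnth y2 i, tnth s2 i))).
  rewrite -sum_tuple_prod sum_zipt le_eqVlt; apply/orP; left; apply/eqP.
  apply: eq_bigr => y1 _; apply: eq_bigr => s1 _; apply: eq_bigr => i _.
  by rewrite tnth_zipt.
apply: prodr_ile1 => i _; rewrite sum_cond_law_le1 // andbT sumr_ge0 // => a _.
exact: cond_law_ge0.
Qed.

End RateBounds.
End Converse.

(** * Block distortion against the best single-letter estimator *)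

Section Distortion.
Variables (R : realType) (S1 S2 Sh1 Sh2 X Y1 Y2 : finType).
Variables (PS : S1 * S2 -> R) (PY : S1 -> S2 -> X -> Y1 * Y2 -> R).
Hypotheses (hPS : is_pmf PS) (hPY : forall s1 s2 x, is_pmf (PY s1 s2 x)).
Variable c : @Defs.code R S1 Sh1 Sh2 X Y1 Y2.

Local Notation n := (blen c).
Local Notation P := (@block_law R S1 S2 Sh1 Sh2 X Y1 Y2 PS PY c).
Local Notation block_ := (@block R S1 S2 Sh1 Sh2 X Y1 Y2 c).
Local Notation chan := (chan PS PY).
Local Notation M1 := (#|msg c|%:R^-1 : R).
Local Notation letter_ := (@letter S1 S2 X Y1 Y2).

Variables (Sh : finType) (d : S1 * S2 -> Sh -> R) (opt : X -> Y1 -> Y2 -> Sh).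
Hypothesis opt_min : forall x y1 y2 t,
  \sum_s1 \sum_s2 chan x s1 s2 y1 y2 * d (s1, s2) (opt x y1 y2)
    <= \sum_s1 \sum_s2 chan x s1 s2 y1 y2 * d (s1, s2) t.

(** For fixed message, inputs and outputs, the block law factorizes over the states of the letters.
    The [i]-th reconstruction of [est] is then a constant, which [opt] beats knowing only the [i]-th
    input and outputs. *)
Lemma expect_opt_le (est : n.-tuple X -> n.-tuple Y1 -> n.-tuple Y2 -> n.-tuple Sh) :
  expect (letter_law PS PY (input_avg PS PY c))
    (fun l : letter_ => d (lS1 l, lS2 l) (opt (lX l) (lY1 l) (lY2 l)))
  <= expect P (fun o : block_ => n%:R^-1 * \sum_(i < n) d (tnth (bS1 o) i, tnth (bS2 o) i)
                (tnth (est (bX o) (bY1 o) (bY2 o)) i)).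
Proof.
pose h (l : letter_) := d (lS1 l, lS2 l) (opt (lX l) (lY1 l) (lY2 l)).
have n0 : 0 < n%:R :> R by rewrite ltr0n blen_gt0.
rewrite -(ler_pM2l n0) -(sum_letters hPS hPY c h) /expect.
under [leRHS in n%:R * leRHS]eq_bigr do rewrite mulrCA.
rewrite -mulr_sumr mulrA divff ?gt_eqF // mul1r.
under eq_bigr do rewrite mulr_sumr; under [leRHS]eq_bigr do rewrite mulr_sumr.
rewrite exchange_big [leRHS]exchange_big; apply: ler_sum => i _ /=.
rewrite !sum_block; apply: ler_sum => m _; apply: ler_sum => x _.
have E (F : n.-tuple S1 -> n.-tuple S2 -> n.-tuple Y1 -> n.-tuple Y2 -> R) :
    \sum_s1 \sum_s2 \sum_y1 \sum_y2 F s1 s2 y1 y2 = \sum_y1 \sum_y2 \sum_s1 \sum_s2 F s1 s2 y1 y2.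
  under eq_bigr do rewrite exchange_big.
  rewrite exchange_big; apply: eq_bigr => y1 _.
  under eq_bigr do rewrite exchange_big.
  by rewrite exchange_big.
rewrite !E; apply: ler_sum => y1 _; apply: ler_sum => y2 _ /=.
pose F i (s : S1 * S2) := chan (tnth x i) s.1 s.2 (tnth y1 i) (tnth y2 i).
(* Only the last factor depends on the reconstruction [t]; the others are nonnegative. *)
have G t : \sum_s1 \sum_s2 P (m, x, s1, s2, y1, y2) * d (tnth s1 i, tnth s2 i) t =
    M1 * input_law m x y1 y2 * (\prod_(j | j != i) \sum_s F j s) * \sum_s F i s * d s t.
  rewrite -[RHS]mulrA -(sum_tuple_prod_at F (d^~ t)) sum_zipt mulr_sumr.
  apply: eq_bigr => s1 _; rewrite mulr_sumr; apply: eq_bigr => s2 _.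
  rewrite block_lawE -mulrA tnth_zipt; congr (_ * (_ * _)); apply: eq_bigr => j _.
  by rewrite /F tnth_zipt.
rewrite /h /letter_at /= !G ler_wpM2l //.
  rewrite mulr_ge0 ?mulr_ge0 ?input_law_ge0 ?prodr_ge0 ?invr_ge0 ?ler0n // => j _.
  by apply: sumr_ge0 => s _; exact: chan_ge0.
by rewrite !sum_pair; exact: opt_min.
Qed.

End Distortion.

(** * Vanishing slack *)

Section Limits.
Variable R : realType.

(** This is ln u < u at u = 1 / sqrt x. It makes x ln x vanish at 0 from the right. *)
Lemma xlnx_sqrt_le (x : R) : 0 <= x -> x <= 1 -> `|x * ln x| <= 2 * Num.sqrt x.
Proof.
rewrite le_eqVlt => /orP[/eqP<- _|x0 x1]; first by rewrite mul0r normr0 sqrtr0 mulr0.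
have s0 : 0 < Num.sqrt x by rewrite sqrtr_gt0.
have xE : x = Num.sqrt x ^+ 2 by rewrite sqr_sqrtr // ltW.
have : ln (Num.sqrt x)^-1 < (Num.sqrt x)^-1 by apply: ln_sublinear; rewrite invr_gt0.
rewrite lnV ?posrE // => h.
rewrite ler0_norm; last by rewrite mulr_ge0_le0 ?ln_le0 // ltW.
rewrite {1 2}xE expr2 lnM ?posrE //.
set s := Num.sqrt x in s0 h *.
have : s * s * - ln s <= s * s * s^-1 by rewrite ler_wpM2l ?mulr_ge0 ?ltW.
rewrite mulfK ?gt_eqF //; lra.
Qed.

Lemma continuous_xlnx : continuous (fun x : R => x * ln x).
Proof.
move=> x; have [x0|x0|->] := ltgtP x 0.
- rewrite /continuous_at ln0 ?(ltW x0) // mulr0; apply: cvg_near_cst.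
  by near=> y; rewrite ln0 ?mulr0 //; apply: ltW; near: y; exact: lt_nbhsl.
- by apply: continuousM; [exact: cvg_id | exact: continuous_ln].
- rewrite /continuous_at mul0r; apply/cvgrPdist_lt => e e0.
  near=> y; rewrite sub0r normrN.
  have [y0|y0] := leP y 0; first by rewrite ln0 // mulr0 normr0.
  have y1 : y <= 1 by apply: ltW; near: y; apply: lt_nbhsl; exact: ltr01.
  apply: le_lt_trans (xlnx_sqrt_le (ltW y0) y1) _.
  (* The threshold makes 2 sqrt y < e. *)
  have ye : y < (e / 2) ^+ 2.
    by near: y; apply: lt_nbhsl; rewrite exprn_gt0 ?divr_gt0.
  rewrite -ltr_pdivlMl // -[ltRHS]ger0_norm ?mulr_ge0 ?ltW // -sqrtr_sqr ltr_sqrt ?exprn_gt0 ?mulr_gt0 //.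
  by rewrite mulrC.
Unshelve. all: by end_near.
Qed.

Definition simplex k : set 'rV[R]_k :=
  [set v | (forall i, 0 <= v ord0 i) /\ \sum_i v ord0 i = 1].
Arguments simplex : clear implicits.

Lemma continuous_sum_fin (T : topologicalType) (I : finType) (F : I -> T -> R) (Q : pred I) :
  (forall i, continuous (F i)) -> continuous (fun v => \sum_(i | Q i) F i v).
Proof.
by move=> Fc; apply: continuous_big => //; exact: add_continuous.
Qed.

Lemma continuous_mulr_cst (T : topologicalType) (f : T -> R) (a : R) :
  continuous f -> continuous (fun v => f v * a).
Proof. by move=> fc v; apply: cvgM; [exact: fc | exact: cvg_cst]. Qed.

Lemma continuous_subr (T : topologicalType) (f g : T -> R) :
  continuous f -> continuous g -> continuous (fun v => f v - g v).
Proof. by move=> fc gc v; apply: cvgB; [exact: fc | exact: gc]. Qed.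

Lemma compact_simplex k : compact (simplex k).
Proof.
have cI : compact [set v : 'rV[R]_k | forall i, `[0, 1]%classic (v ord0 i)].
  have := @rV_compact R k (fun=> [set` `[0%R, 1%R]]).
  by apply=> i; exact: segment_compact.
have cc i : continuous (fun v : 'rV[R]_k => v ord0 i) by exact: coord_continuous.
apply: (subclosed_compact _ cI).
- rewrite (_ : simplex k = (\bigcap_(i in [set: 'I_k]) (fun v : 'rV[R]_k => v ord0 i) @^-1` [set x | 0 <= x])
    `&` (fun v : 'rV[R]_k => \sum_i v ord0 i) @^-1` [set 1]).
    apply: closedI.
      apply: closed_bigI => i _; apply: preimage_closed; last exact: closed_ge.
      by move=> v _; exact: cc.
    apply: preimage_closed; last exact: closed_eq.
    by move=> v _; exact: continuous_sum_fin.
  by apply/seteqP; split=> v [v0 v1]; split=> // i; [move=> _|]; exact: v0.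
- move=> v [v0 v1] i /=; rewrite in_itv /= v0 /= -v1 (bigD1 i) //= lerDl.
  by apply: sumr_ge0 => j _.
Qed.

(** [G] attains its minimum on the compact simplex. If that minimum were positive, some point would
    have a value of at most half of it. *)
Lemma simplex_limit k (G : 'rV[R]_k -> R) : continuous G ->
  (forall e, 0 < e -> exists2 v, simplex k v & G v <= e) ->
  exists2 v, simplex k v & G v <= 0.
Proof.
move=> Gc Ge.
have [v0 sv0 _] := Ge 1 ltr01.
have [v vs vmin] := @EVT_min_rV _ _ G (simplex k) (ex_intro _ v0 sv0)
  (@compact_simplex k) (continuous_subspaceT Gc).
exists v; first by rewrite inE in vs.
rewrite leNgt; apply/negP => Gv0.
have [w sw Gw] : exists2 w, simplex k w & G w <= G v / 2 by apply: Ge; lra.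
have := vmin w; rewrite inE => /(_ sw); lra.
Qed.

Lemma continuous_maxr (T : topologicalType) (f g : T -> R) :
  continuous f -> continuous g -> continuous (fun x => Num.max (f x) (g x)).
Proof. by move=> fc gc x; apply: continuous_max; [exact: fc|exact: gc]. Qed.

End Limits.
Arguments simplex {R} k _.

(** * Continuity of the single-letter quantities in the input law *)

Section Continuity.
Variables (R : realType) (S1 S2 X Y1 Y2 : finType).
Variables (PS : S1 * S2 -> R) (PY : S1 -> S2 -> X -> Y1 * Y2 -> R).
Hypotheses (hPS : is_pmf PS) (hPY : forall s1 s2 x, is_pmf (PY s1 s2 x)).

Local Notation letter_ := (@letter S1 S2 X Y1 Y2).
Local Notation k := #|X|.

(** Input laws are coded as row vectors to inherit the topology and the compactness results of
    matrices. *)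
Definition vec_pmf (v : 'rV[R]_k) (x : X) : R := v ord0 (enum_rank x).

Local Notation L v := (letter_law PS PY (vec_pmf v) : letter_ -> R).

Lemma vec_pmf_simplex v : simplex k v -> is_pmf (vec_pmf v).
Proof.
move=> [v0 v1]; split=> [x|]; first exact: v0.
rewrite -v1 (reindex enum_rank) //=.
by exists enum_val => x _; rewrite ?enum_rankK ?enum_valK.
Qed.

Lemma simplex_vec_pmf (p : X -> R) : is_pmf p ->
  exists2 v, simplex k v & vec_pmf v = p.
Proof.
move=> [p0 p1]; exists (\row_i p (enum_val i)); last first.
  by apply/funext => x; rewrite /vec_pmf mxE enum_rankK.
split=> [i|]; first by rewrite mxE.
under eq_bigr do rewrite mxE.
rewrite -p1 [RHS](reindex (fun i : 'I_#|X| => enum_val i)) //=.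
by exists enum_rank => x _; rewrite ?enum_rankK ?enum_valK.
Qed.

Lemma continuous_letter_law (l : letter_) : continuous (fun v => L v l).
Proof.
case: l => [[[[x s1] s2] y1] y2]; do 2 apply: continuous_mulr_cst.
exact: coord_continuous.
Qed.

(** The conditional entropy as a difference of sums of x ln x. It is continuous on the whole vector
    space and agrees with [cond_entropy] on the simplex. *)
Definition cond_ent (A B : finType) (f : letter_ -> A) (g : letter_ -> B) (v : 'rV[R]_k) : R :=
  \sum_b (law (L v) g b * ln (law (L v) g b))
   - \sum_p (law (L v) (pair_rv f g) p * ln (law (L v) (pair_rv f g) p)).

Lemma cond_entE (A B : finType) (f : letter_ -> A) (g : letter_ -> B) v :
  simplex k v -> cond_ent f g v = cond_entropy (L v) f g.
Proof.
move=> sv; rewrite cond_entropy_xlnx //.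
exact: (letter_law_ge0 hPS hPY (vec_pmf_simplex sv)).
Qed.

Lemma continuous_cond_ent (A B : finType) (f : letter_ -> A) (g : letter_ -> B) :
  continuous (cond_ent f g).
Proof.
have C (E : finType) (h : letter_ -> E) :
    continuous (fun v => \sum_b (law (L v) h b * ln (law (L v) h b))).
  apply: continuous_sum_fin => b v.
  apply: (@continuous_comp _ _ _ (fun v => law (L v) h b) (fun x => x * ln x)).
    by apply: continuous_sum_fin => l; exact: continuous_letter_law.
  exact: continuous_xlnx.
by apply: continuous_subr; exact: C.
Qed.

Lemma continuous_expect (f : letter_ -> R) : continuous (fun v => expect (L v) f).
Proof.
apply: continuous_sum_fin => l; apply: continuous_mulr_cst.
exact: continuous_letter_law.
Qed.

End Continuity.

(* [tau ^+ 2] is the parameter of the code; every error term is O(tau). *)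
Lemma rate_bound (R : realType) (n r tau N f g leak : R) :
  1 <= n ->   0 < tau -> tau <= 2^-1 -> 0 <= r -> 
  r - tau ^+ 2 <= N / n ->
  leak <= tau ^+ 2 ->
  N <= leak + n * f + g ->
  g <= - ln (1 - tau ^+ 2) + tau ^+ 2 * (N - ln (tau ^+ 2)) ->
  r - f <= (6 + r) * tau.
Proof.
move=> n1 tau0 tau2 r0 rN leak_le NI gle.
have n0 : 0 < n by exact: lt_le_trans n1.
have tt : tau ^+ 2 <= tau * 2^-1 by rewrite expr2 ler_wpM2l // ltW.
have tt0 : 0 < tau ^+ 2 by rewrite exprn_gt0.
have l1 : - ln (1 - tau ^+ 2) <= 2 * tau ^+ 2.
  have p : 0 < 1 - tau ^+ 2 by lra.
  rewrite -lnV ?posrE //.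
  apply: le_trans (ln_le_subr1 _) _; first by rewrite invr_gt0.
  rewrite lerBlDr -[leLHS]mul1r ler_pdivrMr //; nra.
(* From - ln tau < 1 / tau. Taking a square as the code parameter makes this term linear in
   [tau]. *)
have l2 : - (tau ^+ 2 * ln (tau ^+ 2)) <= 2 * tau.
  have : ln tau^-1 < tau^-1 by apply: ln_sublinear; rewrite invr_gt0.
  rewrite lnV ?posrE // => h.
  have : tau ^+ 2 * - ln tau <= tau ^+ 2 * tau^-1 by rewrite ler_wpM2l ?ltW.
  rewrite expr2 mulfK ?gt_eqF // lnM ?posrE //; lra.
have Nn : (r - tau ^+ 2) * n <= N by rewrite -ler_pdivlMr.
have N1 : (1 - tau ^+ 2) * N <= n * f + (3 * tau ^+ 2 + 2 * tau) by lra.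
(* Since [1 <= n], the constant error terms may be multiplied by [n], which then cancels. *)
have N2 : (1 - tau ^+ 2) * ((r - tau ^+ 2) * n) <= n * f + n * (3 * tau ^+ 2 + 2 * tau).
  apply: le_trans (ler_wpM2l _ Nn) _; first lra.
  apply: le_trans N1 _; rewrite lerD2l -[leLHS]mul1r ler_wpM2r //; lra.
have N3 : (1 - tau ^+ 2) * (r - tau ^+ 2) <= f + (3 * tau ^+ 2 + 2 * tau).
  by rewrite -(ler_pM2l n0) mulrDr; lra.
have : tau ^+ 2 * r <= tau * 2^-1 * r by rewrite ler_wpM2r.
have : 0 <= tau ^+ 2 * tau ^+ 2 by rewrite mulr_ge0 // ltW.
have : 0 <= tau * r by rewrite mulr_ge0 // ltW.
lra.
Qed.

(** * Optimal single-letter estimators *)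

Section SingleLetter.
Variables (R : realType) (S1 S2 X Y1 Y2 : finType).
Variables (PS : S1 * S2 -> R) (PY : S1 -> S2 -> X -> Y1 * Y2 -> R).
Hypotheses (hPS : is_pmf PS) (hPY : forall s1 s2 x, is_pmf (PY s1 s2 x)).

Local Notation letter_ := (@letter S1 S2 X Y1 Y2).
Local Notation chan := (chan PS PY).

(* An optimal estimator that does not depend on the input law, so that its
   distortion is linear in that law. *)
Definition opt_est (Sh : finType) (t0 : Sh) (d : S1 * S2 -> Sh -> R) (x : X) (y1 : Y1) (y2 : Y2) : Sh :=
  [arg min_(t < t0) \sum_s1 \sum_s2 chan x s1 s2 y1 y2 * d (s1, s2) t]%O.

Lemma opt_est_min (Sh : finType) (t0 : Sh) (d : S1 * S2 -> Sh -> R) x y1 y2 t :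
  \sum_s1 \sum_s2 chan x s1 s2 y1 y2 * d (s1, s2) (opt_est t0 d x y1 y2)
    <= \sum_s1 \sum_s2 chan x s1 s2 y1 y2 * d (s1, s2) t.
Proof. by rewrite /opt_est; case: arg_minP => // i _; exact. Qed.

(** The Bayes estimator varies with [PX], so the limit argument uses [opt_est]. This lemma returns
    to the Bayes estimator once the input law is fixed. *)
Lemma expect_bayes_le (S Sh : finType) (t0 : Sh) (d : S -> Sh -> R) (lS : letter_ -> S)
    (PX : X -> R) (e : X -> Y1 -> Y2 -> Sh) : is_pmf PX ->
  expect (letter_law PS PY PX)
    (fun l : letter_ => d (lS l) (bayes_est PS PY t0 d lS PX (lX l) (lY1 l) (lY2 l)))
  <= expect (letter_law PS PY PX) (fun l : letter_ => d (lS l) (e (lX l) (lY1 l) (lY2 l))).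
Proof.
move=> hPX; have L0 : forall l : letter_, 0 <= letter_law PS PY PX l := letter_law_ge0 hPS hPY hPX.
apply: (expect_cond_argmin L0 (f := lS) (g := pair_rv lX (pair_rv lY1 lY2))
  (e := fun b => bayes_est PS PY t0 d lS PX b.1 b.2.1 b.2.2)
  (fun b => e b.1 b.2.1 b.2.2)) => -[x [y1 y2]] t /=.
by rewrite /bayes_est; case: arg_minP => // i _; exact.
Qed.

End SingleLetter.

(** * One input law for all the bounds *)

Unset Implicit Arguments.

Theorem proposition4 (R : realType) (S1 S2 Sh1 Sh2 X Y1 Y2 : finType)
    (PS : S1 * S2 -> R) (PY : S1 -> S2 -> X -> Y1 * Y2 -> R)
    (d1 : S1 -> Sh1 -> R) (d2 : S2 -> Sh2 -> R)
    (t1 : Sh1) (t2 : Sh2)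
    (hPS : is_pmf PS)
    (hPY : forall s1 s2 x, is_pmf (PY s1 s2 x))
    (hd1 : forall s t, 0 <= d1 s t)
    (hd2 : forall s t, 0 <= d2 s t) :
  region_POF PS PY d1 d2 `<=`
    \bigcup_(PX in [set p : X -> R | is_pmf p])
       outer_region PS PY d1 d2 t1 t2 PX.
Proof.
move=> [[r D1] D2] cl.
have close e : 0 < e -> exists r' D1' D2', [/\ achievable PS PY d1 d2 (r', D1', D2'),
    `|r - r'| < e, `|D1 - D1'| < e & `|D2 - D2'| < e].
  move=> e0; have [[[r' D1'] D2'] [ach [[b1 b2] b3]]] := cl _ (nbhsx_ballx (r, D1, D2) e e0).
  by exists r', D1', D2'.
have r0 : 0 <= r.
  rewrite leNgt; apply/negP => r0.
  have [|r' [_ [_ [[r'0 _] + _ _]]]] := close (- r); first by rewrite oppr_gt0.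
  by rewrite ltr_norml => /andP[h _]; lra.
pose e1 := opt_est PS PY t1 (fun s t => d1 s.1 t).
pose e2 := opt_est PS PY t2 (fun s t => d2 s.2 t).
pose E1 v := expect (letter_law PS PY (vec_pmf v))
  (fun l : @letter S1 S2 X Y1 Y2 => d1 (lS1 l) (e1 (lX l) (lY1 l) (lY2 l))).
pose E2 v := expect (letter_law PS PY (vec_pmf v))
  (fun l : @letter S1 S2 X Y1 Y2 => d2 (lS2 l) (e2 (lX l) (lY1 l) (lY2 l))).
pose F1 v := cond_ent PS PY (pair_rv lY1 lS1) (pair_rv lY2 lS2) v
  - cond_ent PS PY lS1 (pair_rv (pair_rv lY1 lY2) (pair_rv lS2 lX)) v.
pose F2 v := cond_ent PS PY lX lS1 v - cond_ent PS PY lX (pair_rv lY1 lS1) v.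
(* All four constraints are packed into one continuous function: they hold together exactly when
   [G v <= 0]. *)
pose G (v : 'rV[R]_#|X|) :=
  Num.max (Num.max (r - F1 v) (r - F2 v)) (Num.max (E1 v - D1) (E2 v - D2)).
have [v sv] : exists2 v, simplex #|X| v & G v <= 0.
  apply: simplex_limit.
    apply: continuous_maxr; apply: continuous_maxr; apply: continuous_subr.
    - exact: cst_continuous.
    - by apply: continuous_subr; exact: continuous_cond_ent.
    - exact: cst_continuous.
    - by apply: continuous_subr; exact: continuous_cond_ent.
    - exact: continuous_expect.
    - exact: cst_continuous.
    - exact: continuous_expect.
    - exact: cst_continuous.
  move=> e e0.
  have r8 : 0 < 8 + r by lra.
  (* The bound 1/2 is required by [rate_bound]. The constant [8 + r] collects [6 + r'] from that
     lemma, one [tau] for [r - r'], and one for replacing [r'] by [r]. *)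
  pose tau := Num.min (2^-1 : R) (e / (8 + r)).
  have tau0 : 0 < tau by rewrite lt_min invr_gt0 ltr0n divr_gt0.
  have tau2 : tau <= 2^-1 by rewrite ge_min lexx.
  have taue : (8 + r) * tau <= e by rewrite mulrC -ler_pdivlMr // ge_min lexx orbT.
  have tt0 : 0 < tau ^+ 2 by rewrite exprn_gt0.
  have tt : tau ^+ 2 <= tau * 2^-1 by rewrite expr2 ler_wpM2l // ltW.
  have [r' [D1' [D2' [[r'0 ach]]]]] := close _ tau0.
  rewrite !ltr_norml => /andP[rl rr] /andP[D1l D1r] /andP[D2l D2r].
  have [c [rc ec lc dc1 dc2]] := ach _ tt0.
  have [v sv vE] := simplex_vec_pmf (input_avg_pmf hPS hPY c).
  have tt1 : tau ^+ 2 < 1 by lra.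
  have n1 : 1 <= (blen c)%:R :> R by rewrite ler1n blen_gt0.
  have gle := expect_ln_fano hPS hPY tt0 tt1 ec.
  have rt : r' * tau <= r * tau + tau.
    apply: (@le_trans _ _ ((r + tau) * tau)); first by rewrite ler_wpM2r ?ltW //; lra.
    by rewrite mulrDl -expr2; lra.
  have rate_le f leak : leak <= tau ^+ 2 -> ln #|msg c|%:R <= leak + (blen c)%:R * f -
      \sum_(o : @block R S1 S2 Sh1 Sh2 X Y1 Y2 c)
        block_law PS PY o * ln (fano (tau ^+ 2) (bM o) (bY1 o) (bS1 o)) -> r - f <= e.
    move=> leak0 Nle; have := rate_bound n1 tau0 tau2 r'0 rc leak0 Nle gle.
    by nra.
  exists v => //; rewrite /G !ge_max; apply/andP; split; apply/andP; split.
  - apply: (rate_le _ _ lc); rewrite /F1 !(cond_entE hPS hPY) // vE.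
    exact: ln_msg_le_rate_leak.
  (* The reliability bound contains no leakage, so 0 is taken in its place. *)
  - apply: (rate_le _ 0 (ltW tt0)); rewrite add0r /F2 !(cond_entE hPS hPY) // vE.
    exact: ln_msg_le_mutual_info.
  - have := expect_opt_le hPS hPY (opt_est_min PS PY t1 (fun s t => d1 s.1 t)) (@est1 _ _ _ _ _ _ _ c).
    rewrite -vE => /le_trans /(_ dc1) h; rewrite lerBlDr; apply: le_trans h _.
    have : 0 <= r * tau by rewrite mulr_ge0 // ltW.
    lra.
  - have := expect_opt_le hPS hPY (opt_est_min PS PY t2 (fun s t => d2 s.2 t)) (@est2 _ _ _ _ _ _ _ c).
    rewrite -vE => /le_trans /(_ dc2) h; rewrite lerBlDr; apply: le_trans h _.
    have : 0 <= r * tau by rewrite mulr_ge0 // ltW.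
    lra.
rewrite /G !ge_max !subr_le0 => /andP[/andP[h1 h2] /andP[h3 h4]].
have hv := vec_pmf_simplex sv.
exists (vec_pmf v) => //; split=> //.
- exact: le_trans (expect_bayes_le hPS hPY t1 d1 lS1 e1 hv) h3.
- exact: le_trans (expect_bayes_le hPS hPY t2 d2 lS2 e2 hv) h4.
- by rewrite le_min -!(cond_entE hPS hPY) // /cond_mutual_info -!(cond_entE hPS hPY) // h1 h2.
Qed.
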